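(* Let $(K,A)$ be a valued field, $U_A$ the set of invertible elements of $A$ and $I_A$ the maximal ideal of $A$. Suppose that $(K',A')$ is an algebraically closed valued field extension of $(K,A)$ (so that $A=A'\cap K$), and denote by $U_{A'}$ the set of invertible elements of $A'$ and by $I_{A'}$ the maximal ideal of $A'$. Let $R_{=0},R_{\neq0},R_{\mathrm{Vr}},R_{\mathrm{Rn}},R_{\mathrm{U}}$ be five finite families of elements of the polynomial ring $K[x]=K[x_1,\dots,x_r]$. Let - $\mathcal I_{=0}$ be the ideal of $K[x]$ generated by $R_{=0}$, - $\mathcal M_{\neq0}$ the (multiplicative) monoid of $K[x]$ generated by $R_{\neq0}$, - $\mathcal V_{\mathrm{Vr}}$ the subring of $K[x]$ generated by $R_{\mathrm{Vr}}\cup R_{\mathrm{Rn}}\cup R_{\mathrm{U}}\cup A$, - $\mathcal I_{\mathrm{Rn}}$ the ideal of $\mathcal V_{\mathrm{Vr}}$ generated by $R_{\mathrm{Rn}}\cup I_A$, - $\mathcal M_{\mathrm{U}}$ the (multiplicative) monoid generated by $R_{\mathrm{U}}\cup U_A$. Let $\mathcal S\subset K'^{\,r}$ be the set of points $x$ such that $n(x)=0$ for all $n\in R_{=0}$, $t(x)\neq0$ for all $t\in R_{\neq0}$, $c(x)\in A'$ for all $c\in R_{\mathrm{Vr}}$, $v(x)\in U_{A'}$ for all $v\in R_{\mathrm{U}}$, and $k(x)\in I_{A'}$ for all $k\in R_{\mathrm{Rn}}$. Then $\mathcal S$ is empty if and only if there is an equality in $K[x]$ $$m(u+j)+i=0$$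 with $m\in\mathcal M_{\neq0}$, $u\in\mathcal M_{\mathrm{U}}$, $j\in\mathcal I_{\mathrm{Rn}}$ and $i\in\mathcal I_{=0}$.
   Context: A valued field $(K,A)$ is a field $K$ together with a valuation ring $A\subset K$ (a subring such that for every nonzero $a\in K$, $a\in A$ or $a^{-1}\in A$). An algebraically closed valued field is a valued field whose underlying field is algebraically closed. Generated monoids are multiplicative and always contain $1$.
   Formalization: The algebraically closed valued field (K',A') is additionally assumed not trivially valued (A' ≠ K'); for A' = K' the claim fails, e.g. K = K' = A = A', r = 1, R_Rn = R_≠0 = {x}, other families empty. (K,A) may still be trivially valued. *)

(* Defs.v *)
From HB Require Import structures.
From mathcomp Require Import all_boot all_order all_algebra.
From mathcomp Require Import mpoly.

Set Implicit Arguments.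
Unset Strict Implicit.
Unset Printing Implicit Defensive.

Import GRing.Theory.

Local Open Scope ring_scope.

Section ValuationRing.

Variable K : fieldType.
Implicit Types (A I : {pred K}).

Definition valuation_ring A : Prop :=
  subring_closed A /\ forall a, a != 0 -> (a \in A) || (a^-1 \in A).

Definition val_unit A : {pred K} :=
  [pred a | [&& a != 0, a \in A & a^-1 \in A]].

(* The non-units; [val_max_ideal] and [val_max_largest] show that, A being a
   valuation ring, this is its largest proper ideal, hence its unique maximal
   ideal. *)
Definition val_max A : {pred K} :=
  [pred a | (a \in A) && (a \notin val_unit A)].

Definition proper_ideal_of A I : Prop :=
  [/\ {subset I <= A}, 0 \in I, 1 \notin I,
      {in I &, forall a b, a + b \in I}
    & {in A & I, forall c a, c * a \in I}].

Lemma val_unitP A a :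
  reflect (a \in A /\ exists2 b, b \in A & a * b = 1) (a \in val_unit A).
Proof.
rewrite inE; apply: (iffP and3P) => [[a0 aA aVA] | [aA [b bA ab1]]].
  by split=> //; exists a^-1; rewrite ?divff.
have a0 : a != 0.
  by apply: contra_eq_neq ab1 => ->; rewrite mul0r eq_sym oner_eq0.
split=> //; suff -> : a^-1 = b by [].
by apply: (mulfI a0); rewrite ab1 divff.
Qed.

Lemma val_max_ideal A : valuation_ring A -> proper_ideal_of A (val_max A).
Proof.
case=> [[A1 AB AM] AV].
have A0 : 0 \in A by rewrite -(subrr 1) AB.
have AD : {in A &, forall a b, a + b \in A}.
  by move=> a b aA bA; rewrite -[b]opprK AB // -sub0r AB.
have MM : {in A & val_max A, forall c a, c * a \in val_max A}.
  move=> c a cA /andP[aA aU]; rewrite inE AM //=; apply: contra aU.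
  move=> /val_unitP[_ [b bA cab]]; apply/val_unitP; split=> //.
  by exists (c * b); rewrite ?AM // mulrCA mulrA.
have D (a b : K) : b != 0 -> a / b \in A -> b \in val_max A ->
    a + b \in val_max A.
  move=> b0 abA bM; have -> : a + b = (a / b + 1) * b.
    by rewrite mulrDl mul1r divfK.
  by apply: MM => //; apply: AD.
split=> //.
- by move=> a /andP[].
- by rewrite !inE eqxx A0.
- by rewrite !inE invr1 A1 oner_eq0.
move=> a b aM bM.
have [->|a0] := eqVneq a 0; first by rewrite add0r.
have [->|b0] := eqVneq b 0; first by rewrite addr0.
have ab0 : a / b != 0 by rewrite mulf_neq0 ?invr_eq0.
have /orP[abA|] := AV _ ab0; first exact: D.
by rewrite invf_div addrC => baA; apply: D.
Qed.

Lemma val_max_largest A I : proper_ideal_of A I -> {subset I <= val_max A}.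
Proof.
case=> [sIA _ I1 _ IM] a aI; rewrite inE sIA //=.
by apply: contra I1 => /val_unitP[_ [b bA <-]]; rewrite mulrC IM.
Qed.

End ValuationRing.

Inductive monoid_gen (R : pzRingType) (G : R -> Prop) : R -> Prop :=
| MonoidGen_gen p of G p : monoid_gen G p
| MonoidGen_one : monoid_gen G 1
| MonoidGen_mul p q of monoid_gen G p & monoid_gen G q : monoid_gen G (p * q).

Inductive subring_gen (R : pzRingType) (G : R -> Prop) : R -> Prop :=
| SubringGen_gen p of G p : subring_gen G p
| SubringGen_one : subring_gen G 1
| SubringGen_sub p q of subring_gen G p & subring_gen G q :
    subring_gen G (p - q)
| SubringGen_mul p q of subring_gen G p & subring_gen G q :
    subring_gen G (p * q).

(* The ideal of the subring V of R generated by G, for G contained in V. *)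
Inductive ideal_gen (R : comPzRingType) (V G : R -> Prop) : R -> Prop :=
| IdealGen_gen p of G p : ideal_gen V G p
| IdealGen_zero : ideal_gen V G 0
| IdealGen_add p q of ideal_gen V G p & ideal_gen V G q :
    ideal_gen V G (p + q)
| IdealGen_mul c p of V c & ideal_gen V G p : ideal_gen V G (c * p).

Section Families.

Variables (K : fieldType) (A : {pred K}) (r : nat).

Definition const_in (B : {pred K}) (p : {mpoly K[r]}) : Prop :=
  exists2 a, a \in B & p = a%:MP.

Definition I_eq0 (Req0 : seq {mpoly K[r]}) : {mpoly K[r]} -> Prop :=
  ideal_gen (fun=> True) (fun p => p \in Req0).

Definition M_neq0 (Rneq0 : seq {mpoly K[r]}) : {mpoly K[r]} -> Prop :=
  monoid_gen (fun p => p \in Rneq0).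

Definition V_Vr (RVr RRn RU : seq {mpoly K[r]}) : {mpoly K[r]} -> Prop :=
  subring_gen
    (fun p => [\/ p \in RVr, p \in RRn, p \in RU | const_in A p]).

Definition I_Rn (RVr RRn RU : seq {mpoly K[r]}) : {mpoly K[r]} -> Prop :=
  ideal_gen (V_Vr RVr RRn RU)
    (fun p => p \in RRn \/ const_in (val_max A) p).

Definition M_U (RU : seq {mpoly K[r]}) : {mpoly K[r]} -> Prop :=
  monoid_gen (fun p => p \in RU \/ const_in (val_unit A) p).

Definition solution_set (K' : fieldType) (A' : {pred K'})
    (iota : {rmorphism K -> K'}) (Req0 Rneq0 RVr RRn RU : seq {mpoly K[r]})
    (x : 'I_r -> K') : Prop :=
  let ev p := (map_mpoly iota p).@[x] in
  [/\ {in Req0, forall n, ev n = 0},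
      {in Rneq0, forall t, ev t != 0},
      {in RVr, forall c, ev c \in A'},
      {in RU, forall v, ev v \in val_unit A'}
    & {in RRn, forall k, ev k \in val_max A'}].

End Families.

(* Main.v *)
Require Import Defs.
From HB Require Import structures.
From mathcomp Require Import all_boot all_order all_algebra closed_field.
From mathcomp Require Import mpoly.
From mathcomp Require Import boolp classical_sets functions.
From mathcomp Require Import ring.
Set Implicit Arguments.
Unset Strict Implicit.
Unset Printing Implicit Defensive.
Import GRing.Theory.
Local Open Scope ring_scope.

(** * The Nullstellensatz for algebraically closed valued fields

A certificate m (u + j) + i = 0 cannot coexist with a point: at a point of the
solution set, m is nonzero, u + j is a unit of the valuation ring because j
lies in its maximal ideal, and i vanishes ([point_no_certificate]).

Conversely, the absence of a certificate says that the ideal generated by the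
equations misses the multiplicative monoid of the products m (u + j).  A prime
ideal containing the former and disjoint from the latter turns K[x] into a
domain, in whose fraction field the image of V_Vr, localised at the elements
u + j, is dominated by a valuation ring.  This yields a point in some valued
extension (L, B) of (K, A) ([valuative_nullstellensatz],
[no_certificate_point]).

It remains to move that point from L to the given algebraically closed field K'
([existentially_closed]), which is done one coordinate at a time, without
elimination of quantifiers.

- A certificate over K' descends to K: it is a solution in K' of a linear system
  over K whose unknowns are constrained to be units, integral, in the maximal
  ideal or arbitrary, and such a system then has a solution in K
  ([linear_descent], [certificate_descent]).  Hence the point in L excludes
  certificates over K', even after the coordinates already lying in K have been
  prescribed by equations, and L may be replaced by a valued extension of K'.
- If some coordinate t of the new point is not in K', then t can be approximated
  by elements of K': finitely many comparisons between the values of the t - a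
  and the values of elements of K' are realised by a point of K'
  ([approximate]).  An ultraproduct M of copies of K' along these
  approximations contains an element with the same comparisons as t
  ([ultraproduct]), and linear comparisons determine the valuation of the
  rational functions, since K' is algebraically closed ([transfer]).  So the
  valued field K'(t) embeds both in L and in M, and over K'(t) one more
  coordinate is known.  By induction there is a point in M, and a point in an
  ultraproduct of K' comes from points in K' ([los]). *)

(** * Valuation rings *)

Section ValuationRingTheory.

Variables (K : fieldType) (A : {pred K}).
Hypothesis hA : valuation_ring A.

Lemma vring1 : 1 \in A. Proof. by case: hA => [[]]. Qed.

Lemma vringB x y : x \in A -> y \in A -> x - y \in A.
Proof. by case: hA => [[_ h _] _]; apply: h. Qed.

Lemma vringM x y : x \in A -> y \in A -> x * y \in A.
Proof. by case: hA => [[_ _ h] _]; apply: h. Qed.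

Lemma vring0 : 0 \in A. Proof. by rewrite -(subrr 1) vringB ?vring1. Qed.

Lemma vringN x : x \in A -> - x \in A.
Proof. by move=> xA; rewrite -sub0r vringB ?vring0. Qed.

Lemma vringD x y : x \in A -> y \in A -> x + y \in A.
Proof. by move=> xA yA; rewrite -[y]opprK vringB ?vringN. Qed.

Lemma vmax_vring x : x \in val_max A -> x \in A.
Proof. by case/andP. Qed.

Lemma vmax0 : 0 \in val_max A.
Proof. by case: (val_max_ideal hA). Qed.

Lemma vmax1 : 1 \notin val_max A.
Proof. by case: (val_max_ideal hA). Qed.

Lemma vmaxD x y : x \in val_max A -> y \in val_max A -> x + y \in val_max A.
Proof. by case: (val_max_ideal hA) => _ _ _ h _; apply: h. Qed.

Lemma vmaxMl x y : x \in A -> y \in val_max A -> x * y \in val_max A.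
Proof. by case: (val_max_ideal hA) => _ _ _ _ h; apply: h. Qed.

Lemma vmaxMr x y : x \in val_max A -> y \in A -> x * y \in val_max A.
Proof. by move=> *; rewrite mulrC vmaxMl. Qed.

Lemma vmaxN x : x \in val_max A -> - x \in val_max A.
Proof. by move=> xm; rewrite -mulN1r vmaxMl ?vringN ?vring1. Qed.

Lemma vmaxE x : x != 0 -> (x \in val_max A) = (x^-1 \notin A).
Proof.
move=> x0; rewrite inE [x \in val_unit A]inE x0 /=.
by case: hA => _ /(_ x x0); case: (x \in A) => //= ->.
Qed.

Lemma vring_notin x : x \notin A -> x^-1 \in val_max A.
Proof.
move=> xA; have x0 : x != 0 by apply: contraNneq xA => ->; rewrite vring0.
by rewrite vmaxE ?invr_eq0 // invrK.
Qed.

Lemma vunitE x : (x \in val_unit A) = [&& x != 0, x \in A & x^-1 \in A].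
Proof. by []. Qed.

Lemma vunit_neq0 x : x \in val_unit A -> x != 0.
Proof. by case/and3P. Qed.

Lemma vunit_vring x : x \in val_unit A -> x \in A.
Proof. by case/and3P. Qed.

Lemma vunitV x : x \in val_unit A -> x^-1 \in val_unit A.
Proof. by case/and3P=> x0 xA xV; rewrite vunitE invr_eq0 invrK x0 xV. Qed.

Lemma vunit1 : 1 \in val_unit A.
Proof. by rewrite vunitE oner_eq0 invr1 vring1. Qed.

Lemma vunitM x y :
  x \in val_unit A -> y \in val_unit A -> x * y \in val_unit A.
Proof.
move=> /and3P[x0 xA xV] /and3P[y0 yA yV].
by rewrite vunitE mulf_neq0 // invfM !vringM.
Qed.

Lemma vunit_notmax x : x \in val_unit A -> x \notin val_max A.
Proof. by move=> xU; rewrite inE xU andbF. Qed.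

Lemma vunitI x : x \in A -> x \notin val_max A -> x \in val_unit A.
Proof. by move=> xA; rewrite inE xA negbK. Qed.

Lemma vunitDmax x y :
  x \in val_unit A -> y \in val_max A -> x + y \in val_unit A.
Proof.
move=> xU ym; apply: vunitI; first by apply: vringD;
  [apply: vunit_vring|apply: vmax_vring].
apply: contra (vunit_notmax xU) => xym.
by rewrite -[x](addrK y) vmaxD ?vmaxN.
Qed.

Lemma vringX n x : x \in A -> x ^+ n \in A.
Proof. by move=> xA; elim: n => [|n IH]; rewrite ?vring1 // exprS vringM. Qed.

Lemma vmaxX n x : x \in val_max A -> x ^+ n.+1 \in val_max A.
Proof. by move=> xm; rewrite exprS vmaxMr ?vringX ?vmax_vring. Qed.

(** Valuation rings are integrally closed. *)
Lemma vringXK n x : x ^+ n.+1 \in A -> x \in A.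
Proof.
move=> xn; apply: contraT => xA.
have x0 : x != 0 by apply: contraNneq xA => ->; rewrite vring0.
have := vmaxMl xn (vmaxX n (vring_notin xA)).
by rewrite -exprMn divff // expr1n (negPf vmax1).
Qed.

Lemma vmaxXK n x : x ^+ n.+1 \in val_max A -> x \in val_max A.
Proof.
have [->|x0] := eqVneq x 0; first by rewrite vmax0.
move=> xn; rewrite vmaxE //; apply/negP => xV.
have := vmaxMr xn (vringX n.+1 xV).
by rewrite -exprMn divff // expr1n (negPf vmax1).
Qed.

(** Divisibility by a valuation ring is a total preorder, so a finite family has
    an element of largest absolute value. *)
Lemma vring_pivot (T : eqType) (f : T -> K) (s : seq T) :
  (exists2 i, i \in s & f i != 0) ->
  exists i, [/\ i \in s, f i != 0 & {in s, forall k, f k / f i \in A}].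
Proof.
elim: s => [|k s IH] [i]; first by rewrite in_nil.
have [/hasP[i1 i1s fi1] _ _|/hasPn s0] := boolP (has (fun i => f i != 0) s).
  have [|i2 [i2s fi2 i2P]] := IH; first by exists i1.
  have [ki2|ki2] := boolP (f k / f i2 \in A).
    exists i2; split=> //; first by rewrite inE i2s orbT.
    by move=> l; rewrite inE => /predU1P[->//|/i2P].
  have k0 : f k != 0 by apply: contraNneq ki2 => ->; rewrite mul0r vring0.
  exists k; split=> //; first by rewrite inE eqxx.
  move=> l; rewrite inE => /predU1P[->|/i2P li2]; first by rewrite divff ?vring1.
  have := vmax_vring (vring_notin ki2); rewrite invf_div => i2k.
  by rewrite -[f l](divfK fi2) -[X in X \in _]mulrA vringM.
rewrite inE => /predU1P[-> k0|/s0/negP//].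
exists k; split=> //; first by rewrite inE eqxx.
move=> l; rewrite inE => /predU1P[->|/s0]; first by rewrite divff ?vring1.
by rewrite negbK => /eqP->; rewrite mul0r vring0.
Qed.

Lemma vring_unitMl u x : u \in val_unit A -> (u * x \in A) = (x \in A).
Proof.
move=> uU; apply/idP/idP => [uxA|xA].
  rewrite -[x](mulKf (vunit_neq0 uU)); apply: vringM => //.
  exact: vunit_vring (vunitV uU).
by apply: vringM => //; apply: vunit_vring.
Qed.

Lemma vunitN u : u \in val_unit A -> - u \in val_unit A.
Proof.
case/and3P=> u0 uA uV.
by apply/and3P; split; rewrite ?oppr_eq0 ?invrN ?vringN.
Qed.

Lemma vunitBmax x y :
  x \in val_max A -> y \in val_unit A -> x - y \in val_unit A.
Proof. by move=> xm yU; rewrite addrC vunitDmax ?vunitN. Qed.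

Lemma vmax_notin x : x != 0 -> x \in val_max A -> x^-1 \notin A.
Proof. by move=> x0; rewrite vmaxE. Qed.

Lemma val_trichotomy x : x != 0 ->
  [\/ x \in val_unit A, x \in val_max A | x^-1 \in val_max A].
Proof.
move=> x0; have [xA|/vring_notin] := boolP (x \in A); last by constructor 3; auto.
have [|xm] := boolP (x \in val_max A); first by constructor 2.
by constructor 1; apply: vunitI.
Qed.

End ValuationRingTheory.

Section Extension.
Variables (K K' : fieldType) (A : {pred K}) (A' : {pred K'}).
Variable iota : {rmorphism K -> K'}.
Hypothesis hAA' : forall a, (iota a \in A') = (a \in A).

Lemma ext_unit a : (iota a \in val_unit A') = (a \in val_unit A).
Proof. by rewrite !vunitE fmorph_eq0 -fmorphV !hAA'. Qed.

Lemma ext_max a : (iota a \in val_max A') = (a \in val_max A).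
Proof. by rewrite [LHS]inE [RHS]inE ext_unit hAA'. Qed.

End Extension.

Definition pullback (E L : fieldType) (psi : E -> L) (B : {pred L}) : {pred E} :=
  [pred x | psi x \in B].

Lemma pullback_valuation (E L : fieldType) (psi : {rmorphism E -> L}) (B : {pred L}) :
  valuation_ring B -> valuation_ring (pullback psi B).
Proof.
move=> hB; split=> [|a a0].
  split=> [|x y|x y]; rewrite !inE /= ?rmorph1 ?vring1 //.
    by rewrite rmorphB; apply: vringB.
  by rewrite rmorphM; apply: vringM.
rewrite !inE /= fmorphV; case: hB => _; apply; rewrite fmorph_eq0.
exact: a0.
Qed.

(** * Prime ideals, Chevalley extension and the abstract Nullstellensatz *)

Section ZornAbove.
Local Open Scope classical_set_scope.

(** Zorn's lemma above a given set: only nonempty chains have to be bounded. *)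
Lemma Zorn_above (T : Type) (P : set T -> Prop) (V : set T) :
    P V ->
    (forall C : set (set T), C !=set0 -> total_on C subset ->
       (forall X, C X -> P X) -> P (\bigcup_(X in C) X)) ->
  exists B, [/\ V `<=` B, P B & forall X, B `<=` X -> P X -> X `<=` B].
Proof.
move=> PV Pchain.
have [|B [PB maxB]] := @Zorn_bigcup T (fun X => P (V `|` X)).
  move=> F FP Ftot.
  pose C : set (set T) := [set Y | Y = V \/ exists2 X, F X & Y = V `|` X].
  have -> : V `|` \bigcup_(X in F) X = \bigcup_(Y in C) Y.
    apply/seteqP; split=> x.
      case=> [Vx|[X FX Xx]]; first by exists V; [left|].
      by exists (V `|` X); [right; exists X|right].
    by case=> Y [->|[X FX ->]]; [left|case; [left|right; exists X]].
  apply: Pchain; first by exists V; left.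
    move=> Y Z [->|[X FX ->]] [->|[X' FX' ->]].
    - by left.
    - by left; apply: subsetUl.
    - by right; apply: subsetUl.
    by have [XX'|X'X] := Ftot _ _ FX FX'; [left|right]; apply: setUS.
  by move=> Y [->//|[X FX ->]]; apply: FP.
exists (V `|` B); split=> // X VBX PX.
have VBX' : V `|` X = X by apply/setUidPr => x Vx; apply: VBX; left.
apply: contrapT => nXB; apply: (maxB X); last by rewrite VBX'.
split; last by move=> XB; apply: nXB => x /XB; right.
by move=> x Bx; apply: VBX; right.
Qed.

Lemma chain_pair (T : Type) (C : set (set T)) (x y : T) :
    total_on C subset ->
    (\bigcup_(X in C) X) x -> (\bigcup_(X in C) X) y ->
  exists2 X, C X & X x /\ X y.
Proof.
move=> Ctot [X CX Xx] [Y CY Yy].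
by have [XY|YX] := Ctot _ _ CX CY; [exists Y|exists X] => //; split=> //; auto.
Qed.

End ZornAbove.

Definition subring_pred (R : pzRingType) (V : R -> Prop) : Prop :=
  [/\ V 1, forall x y, V x -> V y -> V (x - y)
    & forall x y, V x -> V y -> V (x * y)].

Definition monoid_pred (R : pzRingType) (M : R -> Prop) : Prop :=
  M 1 /\ forall x y, M x -> M y -> M (x * y).

Definition ideal_pred (R : pzRingType) (V J : R -> Prop) : Prop :=
  [/\ J 0, forall x y, J x -> J y -> J (x + y)
    & forall c x, V c -> J x -> J (c * x)].

Lemma tofracP (R : idomainType) (y : {fraction R}) :
  exists a b : R, b != 0 /\ y = FracField.tofrac a / FracField.tofrac b.
Proof.
elim/quotW: y => x; exists (frac x).1, (frac x).2.
have x2 := denom_ratioP x; split=> //.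
have d0 : FracField.tofrac (frac x).2 != 0 by rewrite tofrac_eq0.
apply: (mulIf d0); rewrite divfK //; unlock FracField.tofrac.
rewrite -[LHS]FracField.pi_mul; apply/eqmodP/eqP => /=.
by rewrite /FracField.mulf !numden_Ratio ?(oner_neq0, mulf_neq0) ?mulr1 //= mulrC.
Qed.

(** An [idomainType] comes with an inverse operation; here it is obtained by
    choice. *)
Lemma integral_idomain (D : comNzRingType) :
    (forall x y : D, x * y = 0 -> (x == 0) || (y == 0)) ->
  exists (D' : idomainType) (iota : {rmorphism D -> D'}), bijective iota.
Proof.
move=> intD.
pose u : pred D := fun x => `[< exists y, y * x = 1 >].
pose inv (x : D) : D := xget x [set y | y * x = 1]%classic.
have uP : {in u, left_inverse 1 inv *%R}.
  by move=> x /asboolP; apply: xgetPex.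
have uPl (x y : D) : y * x = 1 -> u x by move=> yx; apply/asboolP; exists y.
have uout : {in [predC u], inv =1 id}.
  move=> x; rewrite inE => /asboolP nx; rewrite /inv.
  by apply: xgetPN => y /= yx; apply: nx; exists y.
pose DU : comUnitRingType := HB.pack (GRing.ComNzRing.sort D)
  (GRing.ComNzRing_hasMulInverse.Build D uP uPl uout).
pose DI : idomainType := HB.pack (GRing.ComUnitRing.sort DU)
  (GRing.ComUnitRing_isIntegral.Build DU intD).
by exists DI, (idfun : {rmorphism D -> D}); exists id.
Qed.

Section PrimeIdeals.
Variable R : comNzRingType.

(** An ideal P maximal among those that contain I and avoid S is prime: if x and y
    are not in P, then P + (x) and P + (y) both meet S, hence so does P + (xy). *)
Lemma krull (I S : R -> Prop) :
    ideal_pred (fun=> True) I -> monoid_pred S -> (forall x, I x -> ~ S x) ->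
  exists P : R -> Prop,
    [/\ ideal_pred (fun=> True) P, forall x, I x -> P x,
       forall x, P x -> ~ S x & forall x y, P (x * y) -> P x \/ P y].
Proof.
move=> idI [S1 SM] IS.
have [//|C [X0 CX0] Ctot CP|P [IP [idP PS] maxP]] := Zorn_above
    (P := fun X => ideal_pred (fun=> True) X /\ forall x, X x -> ~ S x)
    (V := I).
  split; last by move=> x [X CX Xx]; have [_] := CP _ CX; apply.
  split.
  - by have [[X00 _ _] _] := CP _ CX0; exists X0.
  - move=> x y Ux Uy; have [X CX [Xx Xy]] := chain_pair Ctot Ux Uy.
    by have [[_ XD _] _] := CP _ CX; exists X => //; apply: XD.
  - move=> c x _ [X CX Xx]; have [[_ _ XM] _] := CP _ CX.
    by exists X => //; apply: XM.
case: (idP) => P0 PD PM.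
exists P; split=> // x y Pxy.
have meetS z : ~ P z -> exists a c, P a /\ S (a + c * z).
  move=> nPz; apply: contrapT => nS; apply: nPz.
  apply: (maxP (fun w => exists a c, P a /\ w = a + c * z)).
  - by move=> w Pw; exists w, 0; rewrite mul0r addr0.
  - split; last by move=> _ [a [c [Pa ->]]] Sac; apply: nS; exists a, c.
    split.
    + by exists 0, 0; rewrite mul0r addr0.
    + move=> _ _ [a [c [Pa ->]]] [a' [c' [Pa' ->]]].
      by exists (a + a'), (c + c'); split; [apply: PD|ring].
    + move=> d _ _ [a [c [Pa ->]]].
      by exists (d * a), (d * c); split; [apply: PM|ring].
  - by exists 0, 1; rewrite add0r mul1r.
apply: contrapT => /not_orP[/meetS[a [c [Pa Sa]]] /meetS[b [d [Pb Sb]]]].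
apply: (PS ((a + c * x) * (b + d * y))); last exact: SM.
have -> : (a + c * x) * (b + d * y) =
    (b + d * y) * a + ((c * x) * b + (c * d) * (x * y)) by ring.
by apply: (PD); [apply: PM|apply: PD; apply: PM].
Qed.

Lemma residue_field (P : R -> Prop) :
    ideal_pred (fun=> True) P -> ~ P 1 ->
    (forall x y, P (x * y) -> P x \/ P y) ->
  exists (F : fieldType) (phi : {rmorphism R -> F}),
    (forall x, phi x = 0 <-> P x) /\
    (forall y, exists a b, phi b != 0 /\ y = phi a / phi b).
Proof.
move=> [P0 PD PM] P1 PI.
pose p : {pred R} := fun x => `[< P x >].
have pP x : reflect (P x) (x \in p) by apply: asboolP.
have idp : idealr_closed p.
  split; [exact/pP|exact/pP|].
  by move=> a u v /pP Pu /pP Pv; apply/pP/PD => //; apply: PM.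
have prp : prime_idealr_closed p.
  by move=> u v /pP/PI[/pP->|/pP->]; rewrite ?orbT.
pose idl : prime_idealr R := HB.pack (p : R -> bool) (isIdealr.Build R p idp)
  (isPrimeIdealrClosed.Build R p prp).
have [D [iota iota_bij]] := integral_idomain (@Quotient.rquot_IdomainAxiom R idl).
have iota_inj := bij_inj iota_bij; case: iota_bij => iotaV _ iotaK.
pose pi := \pi_({ideal_quot idl})%qT.
have pi_eq0 x : (pi x == 0) = (x \in p).
  by rewrite -(rmorph0 pi) -Quotient.idealrBE subr0.
pose phi : {rmorphism R -> {fraction D}} := @FracField.tofrac D \o (iota \o pi).
have phi_eq0 x : (phi x == 0) = (x \in p).
  by rewrite /= tofrac_eq0 -(rmorph0 iota) (inj_eq iota_inj) pi_eq0.
exists {fraction D}, phi; split=> [x|y].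
  by split=> [/eqP|Px]; [rewrite phi_eq0 => /pP|apply/eqP; rewrite phi_eq0; apply/pP].
have [a [b [b0 ->]]] := tofracP y.
have phiE c : FracField.tofrac c = phi (repr (iotaV c)).
  by rewrite /= /pi reprK iotaK.
by exists (repr (iotaV a)), (repr (iotaV b)); rewrite -!phiE tofrac_eq0.
Qed.
End PrimeIdeals.

Section IdealGen.
Variable R : comNzRingType.
Implicit Types V J : R -> Prop.

Lemma ideal_gen_pred V J : ideal_pred V (ideal_gen V J).
Proof. by split; [apply: IdealGen_zero|apply: IdealGen_add|apply: IdealGen_mul]. Qed.

Lemma ideal_genS V V' J p :
  (forall x, V x -> V' x) -> ideal_gen V J p -> ideal_gen V' J p.
Proof.
move=> VV'; elim=> {p} [p Jp||p q _ IHp _ IHq|c p Vc _ IHp].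
- exact: IdealGen_gen.
- exact: IdealGen_zero.
- exact: IdealGen_add.
- by apply: IdealGen_mul => //; apply: VV'.
Qed.

Lemma subring0 V : subring_pred V -> V 0.
Proof. by case=> V1 VB _; rewrite -(subrr 1); apply: VB. Qed.

Lemma subringN V x : subring_pred V -> V x -> V (- x).
Proof. by move=> Vr Vx; rewrite -sub0r; case: (Vr) => _ VB _; apply: VB => //;
  apply: subring0. Qed.

Lemma subringD V x y : subring_pred V -> V x -> V y -> V (x + y).
Proof.
move=> Vr Vx Vy; rewrite -[y]opprK.
by case: (Vr) => _ VB _; apply: VB => //; apply: subringN.
Qed.

Lemma ideal_gen_sub V J p : subring_pred V ->
  (forall x, J x -> V x) -> ideal_gen V J p -> V p.
Proof.
move=> Vr JV; elim=> {p} [p /JV//||p q _ IHp _ IHq|c p Vc _ IHp].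
- exact: subring0.
- exact: subringD.
- by case: Vr => _ _; apply.
Qed.

Lemma subring_sum V (I : Type) (s : seq I) (P : pred I) (F : I -> R) :
  subring_pred V -> (forall i, P i -> V (F i)) -> V (\sum_(i <- s | P i) F i).
Proof.
move=> Vr VF; elim/big_ind: _ => //; first exact: subring0.
by move=> x y; apply: subringD.
Qed.

Lemma ideal_sum V J (I : Type) (s : seq I) (P : pred I) (F : I -> R) :
  ideal_pred V J -> (forall i, P i -> J (F i)) -> J (\sum_(i <- s | P i) F i).
Proof. by move=> [J0 JD _] JF; elim/big_ind: _. Qed.

Lemma subringX V x n : subring_pred V -> V x -> V (x ^+ n).
Proof.
by case=> V1 _ VM Vx; elim: n => [|n IH]; rewrite ?expr0 // exprS; apply: VM.
Qed.

End IdealGen.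

Section Chevalley.
Variables (F : fieldType) (J : F -> Prop).

(** The ring generated by x over B, when B is a ring; with an ideal J of B as first
    argument, the ideal generated by J in that ring. *)
Definition adjoin (B : F -> Prop) (x y : F) : Prop :=
  exists2 p : {poly F}, forall i, B p`_i & y = p.[x].

Lemma adjoin_subring (B : F -> Prop) x :
  subring_pred B -> subring_pred (adjoin B x).
Proof.
move=> Br; have B0 := subring0 Br; case: (Br) => B1 BB BM; split.
- by exists 1; rewrite ?hornerC // => i; rewrite coef1; case: (i == _).
- move=> _ _ [p Bp ->] [q Bq ->]; exists (p - q); rewrite ?hornerD ?hornerN //.
  by move=> i; rewrite coefB; apply: BB.
- move=> _ _ [p Bp ->] [q Bq ->]; exists (p * q); rewrite ?hornerM //.
  by move=> i; rewrite coefM; apply: subring_sum => // j _; apply: BM.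
Qed.

Lemma adjoin_ideal (B : F -> Prop) x y : subring_pred B ->
    (forall z, J z -> B z) -> ideal_gen (adjoin B x) J y ->
  adjoin (ideal_gen B J) x y.
Proof.
move=> Br JB; have m0 := IdealGen_zero B J.
elim=> {y} [y Jy||_ _ _ [p mp ->] _ [q mq ->]|_ _ [p Bp ->] _ [q mq ->]].
- exists y%:P; rewrite ?hornerC // => i; rewrite coefC.
  by case: (i == _) => //; apply: IdealGen_gen.
- by exists 0; rewrite ?horner0 // => i; rewrite coef0.
- exists (p + q); rewrite ?hornerD // => i; rewrite coefD.
  exact: IdealGen_add.
- exists (p * q); rewrite ?hornerM // => i; rewrite coefM.
  apply: ideal_sum; first exact: ideal_gen_pred.
  by move=> j _; apply: IdealGen_mul.
Qed.

(** The key step of Chevalley's extension theorem: the ideal generated by J cannot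
    become trivial both in B[x] and in B[1/x].  From p(x) = 1 and q(1/x) = 1 with
    coefficients in that ideal and deg q <= deg p, the relation q(1/x) = 1 expresses
    x^n in lower powers of x, because 1 - q_0 is invertible; substituting it for the
    leading monomial of p lowers the degree of p. *)
Lemma adjoin_reduce (B : F -> Prop) (x : F) :
    subring_pred B -> (forall z, J z -> B z) -> ~ ideal_gen B J 1 ->
    (forall b, ideal_gen B J b -> B (1 - b)^-1) -> x != 0 ->
    adjoin (ideal_gen B J) x 1 -> adjoin (ideal_gen B J) x^-1 1 -> False.
Proof.
move=> Br JB J1 invB x0 [p mp px] [q mq qx].
have [k] := ubnP (size p + size q).
elim: k => // k IH in x x0 p mp px q mq qx *.
wlog le_qp : x x0 p mp px q mq qx / (size q <= size p)%N.
  move=> wl le_k; have [|/ltnW le_pq] := leqP (size q) (size p).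
    by move/(wl x x0 p mp px q mq qx); apply.
  apply: (wl x^-1 _ q mq qx p mp _ le_pq).
  - by rewrite invr_eq0.
  - by rewrite invrK.
  - by rewrite addnC.
move=> le_k; set m := ideal_gen B J in mp mq invB IH *.
have [m0 mD mM] := ideal_gen_pred B J.
have Bm z : m z -> B z by apply: ideal_gen_sub.
have BM y z : B y -> B z -> B (y * z) by case: Br => _ _; apply.
case Dn: (size p) => [|n].
  have p0 : p = 0 by apply/eqP; rewrite -size_poly_eq0 Dn.
  by move/eqP: px; rewrite p0 horner0 oner_eq0.
pose w := (1 - q`_0)^-1.
have w0 : 1 - q`_0 != 0.
  by apply/eqP => /subr0_eq q0; apply: J1; rewrite q0; apply: mq.
have Bw : B w by apply: invB; apply: mq.
pose p' := \poly_(i < n) (p`_i + (p`_n * w) * q`_(n - i)).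
have mp' i : m p'`_i.
  rewrite coef_poly; case: ifP => _ //; apply: mD; first exact: mp.
  by apply: mM; [apply: BM => //; apply: Bm|]; apply: mq || apply: mp.
have qE : \sum_(i < n) q`_(n - i) * x ^+ i = x ^+ n * (1 - q`_0).
  have -> : 1 - q`_0 = \sum_(i < n) q`_i.+1 * x^-1 ^+ i.+1.
    have sq : (size q <= n.+1)%N by rewrite -Dn.
    rewrite qx (horner_coef_wide _ sq) big_ord_recl /= expr0 mulr1 addrC addKr.
    by apply: eq_bigr.
  rewrite (reindex_inj rev_ord_inj) mulr_sumr; apply: eq_bigr => /= i _.
  rewrite subKn // mulrCA; congr (_ * _).
  by rewrite exprVn expfB_cond ?(negPf x0) // ltn_ord.
apply: (IH x x0 p' mp' _ q mq qx); last first.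
  rewrite -ltnS; apply: leq_trans le_k; rewrite Dn 2!ltnS leq_add2r.
  exact: size_poly.
have sp : (size p <= n.+1)%N by rewrite Dn.
rewrite horner_poly.
under eq_bigr do rewrite mulrDl -mulrA.
rewrite big_split /= -mulr_sumr qE {1}px (horner_coef_wide _ sp) big_ord_recr /=.
by congr (_ + _); rewrite /w; field.
Qed.

(** A subring B containing V and maximal among those in which J does not generate
    the unit ideal is a valuation ring.  Indeed 1 lies in the ideal generated by J in
    B[x] for each x outside B; applied to x = 1/(1 - b) with b in that ideal, this
    shows that 1 - b is invertible in B, and then [adjoin_reduce] forbids that x and
    1/x both be outside B. *)
Theorem chevalley (V : F -> Prop) :
    subring_pred V -> (forall z, J z -> V z) -> ~ ideal_gen V J 1 ->
  exists B : {pred F}, [/\ valuation_ring B, forall z, V z -> z \in B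
    & forall z, J z -> z \in val_max B].
Proof.
move=> Vr JV J1.
have [//|C [X0 CX0] Ctot CP|B [VB [Br B1] maxB]] := Zorn_above
    (P := fun X => subring_pred X /\ ~ ideal_gen X J 1) (V := V).
  have genC p : ideal_gen (\bigcup_(X in C) X)%classic J p ->
      exists2 X, C X & ideal_gen X J p.
    elim=> {p} [p Jp||p q _ [X CX Xp] _ [Y CY Yq]|c p [X CX Xc] _ [Y CY Yp]].
    - by exists X0 => //; apply: IdealGen_gen.
    - by exists X0 => //; apply: IdealGen_zero.
    - have [XY|YX] := Ctot _ _ CX CY; [exists Y|exists X] => //;
        apply: IdealGen_add => //; [move: Xp|move: Yq]; exact: ideal_genS.
    - have [XY|YX] := Ctot _ _ CX CY; [exists Y|exists X] => //;
        apply: IdealGen_mul; auto; move: Yp; exact: ideal_genS.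
  split; last by move=> /genC[X CX]; have [_] := CP _ CX.
  split.
  - by have [[X01 _ _] _] := CP _ CX0; exists X0.
  - move=> x y Ux Uy; have [X CX [Xx Xy]] := chain_pair Ctot Ux Uy.
    by have [[_ XB _] _] := CP _ CX; exists X => //; apply: XB.
  - move=> x y Ux Uy; have [X CX [Xx Xy]] := chain_pair Ctot Ux Uy.
    by have [[_ _ XM] _] := CP _ CX; exists X => //; apply: XM.
have JB z : J z -> B z by move=> /JV/VB.
have [_ BB BM] := Br.
have [m0 mD mM] := ideal_gen_pred B J.
have adj1 x : ~ B x -> adjoin (ideal_gen B J) x 1.
  move=> nBx; apply: contrapT => n1; apply: nBx; apply: (maxB (adjoin B x)).
  - move=> b Bb; exists b%:P; rewrite ?hornerC // => i; rewrite coefC.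
    by case: (i == _) => //; apply: subring0.
  - split; first exact: adjoin_subring.
    by move/(adjoin_ideal Br JB).
  - exists 'X; rewrite ?hornerX // => i; rewrite coefX.
    by case: (i == _); [case: Br|apply: subring0].
have invB b : ideal_gen B J b -> B (1 - b)^-1.
  move=> mb; apply: contrapT => /adj1[p mp p1].
  have w0 : 1 - b != 0 by apply: contra_notN B1 => /eqP/subr0_eq->.
  have Bw n : B ((1 - b) ^+ n).
    by apply: subringX => //; apply: BB; [case: Br|apply: ideal_gen_sub mb].
  have mw : ideal_gen B J ((1 - b) ^+ size p).
    have -> : (1 - b) ^+ size p =
        \sum_(i < size p) (1 - b) ^+ (size p - i) * p`_i.
      rewrite -[LHS]mulr1 [X in _ * X = _]p1 horner_coef mulr_sumr;
        apply: eq_bigr => i _.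
      rewrite mulrCA [RHS]mulrC exprVn; congr (_ * _).
      by rewrite expfB.
    apply: ideal_sum => [|i _]; first exact: ideal_gen_pred.
    by apply: mM.
  have : forall n, ideal_gen B J ((1 - b) ^+ n) -> ideal_gen B J 1.
    elim=> [|n IH]; rewrite ?expr0 // exprS mulrBl mul1r => mn.
    apply: IH; rewrite -[_ ^+ n](subrK (b * (1 - b) ^+ n)).
    by apply: mD => //; rewrite mulrC; apply: mM.
  by move/(_ _ mw).
exists (fun x => `[< B x >]); split.
- split; first split.
  + by apply/asboolP; case: Br.
  + by move=> x y /asboolP Bx /asboolP By; apply/asboolP/BB.
  + by move=> x y /asboolP Bx /asboolP By; apply/asboolP/BM.
  move=> x x0; apply: contraT => /norP[/asboolP/adj1 x1 /asboolP/adj1 xV1].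
  by case: (adjoin_reduce Br JB B1 invB x0 x1 xV1).
- by move=> z /VB Bz; apply/asboolP.
- move=> z Jz; rewrite inE; apply/andP; split; first exact/asboolP/JB.
  apply/negP => /and3P[z0 _ /asboolP BzV]; apply: B1.
  by rewrite -(mulVf z0); apply: mM => //; apply: IdealGen_gen.
Qed.
End Chevalley.

(** The absence of relations m (u + j) + i = 0 makes I disjoint from the monoid of
    the products m (u + j), hence from it a prime ideal P can be separated.  In the
    fraction field of R / P, the elements j / (u + j') form a proper ideal of the
    ring of the elements v / (u + j), and [chevalley] applies. *)
Theorem valuative_nullstellensatz (R : comNzRingType) (I M V J U : R -> Prop) :
    ideal_pred (fun=> True) I -> monoid_pred M -> subring_pred V ->
    ideal_pred V J -> monoid_pred U ->
    (forall x, J x -> V x) -> (forall x, U x -> V x) ->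
    (forall m u j i, M m -> U u -> J j -> I i -> m * (u + j) + i <> 0) ->
  exists (L : fieldType) (B : {pred L}) (phi : {rmorphism R -> L}),
    [/\ valuation_ring B,
        (forall y, exists a b, phi b != 0 /\ y = phi a / phi b),
        (forall x, I x -> phi x = 0) /\ (forall x, M x -> phi x != 0),
        (forall x, V x -> phi x \in B) /\ (forall x, J x -> phi x \in val_max B)
      & (forall x, U x -> phi x \in val_unit B)].
Proof.
move=> idI [M1 MM] Vr idJ [U1 UM] JV UV noc.
have [J0 JD JM] := idJ; have [V1 VB VM] := Vr; have [I0 _ IM] := idI.
pose S x := exists m u j, [/\ M m, U u, J j & x = m * (u + j)].
have [||P [idP IP PS Ppr]] := krull (I := I) (S := S) idI.
- split; first by exists 1, 1, 0; split=> //; rewrite addr0 mulr1.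
  move=> _ _ [m [u [j [Mm Uu Jj ->]]]] [m' [u' [j' [Mm' Uu' Jj' ->]]]].
  exists (m * m'), (u * u'), (u * j' + (u' + j') * j); split; auto.
    apply: JD; apply: JM => //; first exact: UV.
    by apply: subringD => //; [apply: UV|apply: JV].
  by ring.
- move=> x Ix [m [u [j [Mm Uu Jj xE]]]].
  apply: (noc m u j (- x)) => //; last by rewrite xE subrr.
  by rewrite -mulN1r; apply: IM.
have P1 : ~ P 1 by move/PS; apply; exists 1, 1, 0; split=> //; rewrite addr0 mulr1.
have [L [phi [phi0 phiP]]] := residue_field idP P1 Ppr.
have phiS u j : U u -> J j -> phi (u + j) != 0.
  move=> Uu Jj; apply/eqP => /phi0/PS; apply.
  by exists 1, u, j; split=> //; rewrite mul1r.
pose W y := exists v u j, [/\ V v, U u, J j & y = phi v / phi (u + j)].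
pose JW y := exists k u j, [/\ J k, U u, J j & y = phi k / phi (u + j)].
have JWW y : JW y -> W y by move=> [k [u [j [/JV Vk Uu Jj ->]]]]; exists k, u, j.
have prodU u j u' j' : U u -> J j -> U u' -> J j' ->
    exists u2 j2, [/\ U u2, J j2 & phi (u + j) * phi (u' + j') = phi (u2 + j2)].
  move=> Uu Jj Uu' Jj'; exists (u * u'), (u * j' + (u' + j') * j); split; auto.
    apply: JD; apply: JM => //; first exact: UV.
    by apply: subringD => //; [apply: UV|apply: JV].
  by rewrite -rmorphM; congr (phi _); ring.
have Vuj u j : U u -> J j -> V (u + j).
  by move=> /UV Vu /JV Vj; apply: subringD.
have W1 v : V v -> W (phi v).
  by move=> Vv; exists v, 1, 0; split=> //; rewrite addr0 rmorph1 divr1.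
have Wr : subring_pred W.
  split; first by rewrite -(rmorph1 phi); apply: W1.
  - move=> _ _ [v [u [j [Vv Uu Jj ->]]]] [v' [u' [j' [Vv' Uu' Jj' ->]]]].
    have [u2 [j2 [Uu2 Jj2 E]]] := prodU u j u' j' Uu Jj Uu' Jj'.
    exists (v * (u' + j') - v' * (u + j)), u2, j2; split=> //.
      by apply: VB; apply: VM; auto.
    rewrite -E rmorphB !(rmorphM phi); have := phiS _ _ Uu Jj; have := phiS _ _ Uu' Jj'.
    by move: (phi (u + j)) (phi (u' + j')) => s t t0 s0; field; rewrite s0 t0.
  - move=> _ _ [v [u [j [Vv Uu Jj ->]]]] [v' [u' [j' [Vv' Uu' Jj' ->]]]].
    have [u2 [j2 [Uu2 Jj2 E]]] := prodU u j u' j' Uu Jj Uu' Jj'.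
    exists (v * v'), u2, j2; split; auto.
    by rewrite -E (rmorphM phi) mulf_div.
have JWid : ideal_pred W JW.
  split.
  - by exists 0, 1, 0; split=> //; rewrite rmorph0 mul0r.
  - move=> _ _ [v [u [j [Vv Uu Jj ->]]]] [v' [u' [j' [Vv' Uu' Jj' ->]]]].
    have [u2 [j2 [Uu2 Jj2 E]]] := prodU u j u' j' Uu Jj Uu' Jj'.
    exists ((u' + j') * v + (u + j) * v'), u2, j2; split=> //.
      by apply: JD; apply: JM; auto.
    rewrite -E (rmorphD phi (_ * _)) !(rmorphM phi); have := phiS _ _ Uu Jj;
      have := phiS _ _ Uu' Jj'.
    by move: (phi (u + j)) (phi (u' + j')) => s t t0 s0; field; rewrite s0 t0.
  - move=> _ _ [v [u [j [Vv Uu Jj ->]]]] [v' [u' [j' [Vv' Uu' Jj' ->]]]].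
    have [u2 [j2 [Uu2 Jj2 E]]] := prodU u j u' j' Uu Jj Uu' Jj'.
    exists (v * v'), u2, j2; split; auto.
    by rewrite -E (rmorphM phi) mulf_div.
have JW1 : ~ ideal_gen W JW 1.
  move=> g; have : JW 1.
    have [a b c] := JWid.
    by elim: g => // *; [apply: b|apply: c].
  move=> [k [u [j [Jk Uu Jj E]]]]; have uj0 := phiS _ _ Uu Jj.
  have : phi (u + (j + (-1) * k)) != 0.
    apply: phiS => //; apply: JD => //; apply: JM => //.
    by apply: subringN.
  by rewrite addrA rmorphD mulN1r rmorphN -[phi k](divfK uj0) -E mul1r subrr eqxx.
have [B [hB WB JWB]] := chevalley Wr JWW JW1.
exists L, B, phi; split=> //.
- split=> [x Ix|x Mx]; first by apply/phi0/IP.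
  apply/eqP => /phi0/PS; apply; exists x, 1, 0; split=> //.
  by rewrite addr0 mulr1.
- split=> [x Vx|x Jx]; first by apply: WB; apply: W1.
  by apply: JWB; exists x, 1, 0; split=> //; rewrite addr0 rmorph1 divr1.
- move=> x Ux; have := phiS _ _ Ux J0; rewrite addr0 => x0.
  apply/and3P; split=> //; first by apply: WB; apply: W1; apply: UV.
  apply: WB; exists 1, x, 0; split=> //.
  by rewrite addr0 rmorph1 div1r.
Qed.

(** * Certificates and points of valued extensions *)

Lemma map_mpoly_comp2 (r : nat) (K E1 E2 L : fieldType)
    (f1 : {rmorphism E1 -> L}) (g1 : {rmorphism K -> E1})
    (f2 : {rmorphism E2 -> L}) (g2 : {rmorphism K -> E2}) (p : {mpoly K[r]}) :
    (forall c, f1 (g1 c) = f2 (g2 c)) ->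
  map_mpoly f1 (map_mpoly g1 p) = map_mpoly f2 (map_mpoly g2 p).
Proof. by move=> fg; apply/mpolyP => m; rewrite !mcoeff_map_mpoly /= fg. Qed.

Lemma mpoly_rmorph_eval (r : nat) (K L : fieldType)
    (phi : {rmorphism {mpoly K[r]} -> L}) (iota : {rmorphism K -> L}) (x : 'I_r -> L) :
    (forall c, phi c%:MP = iota c) -> (forall i, phi 'X_i = x i) ->
  forall p, (map_mpoly iota p).@[x] = phi p.
Proof.
move=> phiC phiX; elim/mpolyind => [|c m p _ _ IH]; first by rewrite !rmorph0.
rewrite !rmorphD /= IH map_mpolyZ map_mpolyX mevalZ mevalX.
rewrite -mul_mpolyC rmorphM phiC mpolyXE_id rmorph_prod.
by congr (_ * _ + _); apply: eq_bigr => i _; rewrite rmorphXn /= phiX.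
Qed.

(** The conditions defining the solution set, for an arbitrary evaluation: the
    expressions may be polynomials with coefficients in any field, or functions. *)
Definition satisfies (X : eqType) (L : fieldType) (B : {pred L}) (ev : X -> L)
    (Req0 Rneq0 RVr RRn RU : seq X) : Prop :=
  [/\ {in Req0, forall n, ev n = 0}, {in Rneq0, forall t, ev t != 0},
      {in RVr, forall c, ev c \in B}, {in RU, forall v, ev v \in val_unit B}
    & {in RRn, forall k, ev k \in val_max B}].

Lemma satisfies_map (X Y : eqType) (L : fieldType) (B : {pred L})
    (g : X -> Y) (ev : X -> L) (ev' : Y -> L) Req0 Rneq0 RVr RRn RU :
    (forall p, ev' (g p) = ev p) ->
  satisfies B ev' (map g Req0) (map g Rneq0) (map g RVr) (map g RRn) (map g RU) <->
  satisfies B ev Req0 Rneq0 RVr RRn RU.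
Proof.
move=> gE; split=> -[h1 h2 h3 h4 h5]; split=> p.
- by rewrite -gE => pR; apply: h1; apply: map_f.
- by rewrite -gE => pR; apply: h2; apply: map_f.
- by rewrite -gE => pR; apply: h3; apply: map_f.
- by rewrite -gE => pR; apply: h4; apply: map_f.
- by rewrite -gE => pR; apply: h5; apply: map_f.
- by move=> /mapP[q qR ->]; rewrite gE; apply: h1.
- by move=> /mapP[q qR ->]; rewrite gE; apply: h2.
- by move=> /mapP[q qR ->]; rewrite gE; apply: h3.
- by move=> /mapP[q qR ->]; rewrite gE; apply: h4.
- by move=> /mapP[q qR ->]; rewrite gE; apply: h5.
Qed.

Definition certificate (K : fieldType) (A : {pred K}) (r : nat)
    (Req0 Rneq0 RVr RRn RU : seq {mpoly K[r]}) : Prop :=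
  exists m u j i : {mpoly K[r]},
    [/\ M_neq0 Rneq0 m, M_U A RU u, I_Rn A RVr RRn RU j, I_eq0 Req0 i
      & m * (u + j) + i = 0].

Section Certificates.
Variables (K : fieldType) (A : {pred K}) (r : nat).
Variables (Req0 Rneq0 RVr RRn RU : seq {mpoly K[r]}).
Hypothesis hA : valuation_ring A.

Lemma V_Vr_subring : subring_pred (V_Vr A RVr RRn RU).
Proof. by split; [apply: SubringGen_one|apply: SubringGen_sub|apply:
  SubringGen_mul]. Qed.

Lemma I_Rn_sub j : I_Rn A RVr RRn RU j -> V_Vr A RVr RRn RU j.
Proof.
apply: ideal_gen_sub => [|p [pR|[c /vmax_vring cA ->]]]; first exact: V_Vr_subring.
  by apply: SubringGen_gen; constructor 2.
by apply: SubringGen_gen; constructor 4; exists c.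
Qed.

Lemma M_U_sub u : M_U A RU u -> V_Vr A RVr RRn RU u.
Proof.
elim=> {u} [p [pR|[c /vunit_vring cA ->]]||p q _ Vp _ Vq].
- by apply: SubringGen_gen; constructor 3.
- by apply: SubringGen_gen; constructor 4; exists c.
- exact: SubringGen_one.
- exact: SubringGen_mul.
Qed.

(** If a is not in A, then 1/a is in the maximal ideal of A and its image in that of
    B, so the image of a is not in B: this is why B induces A on K. *)
Theorem no_certificate_point : ~ certificate A Req0 Rneq0 RVr RRn RU ->
  exists (L : fieldType) (B : {pred L}) (iota : {rmorphism K -> L}) (x : 'I_r -> L),
    [/\ valuation_ring B, forall a, (iota a \in B) = (a \in A)
      & solution_set B iota Req0 Rneq0 RVr RRn RU x].
Proof.
move=> noc.
have idI : ideal_pred (fun=> True) (I_eq0 Req0) by apply: ideal_gen_pred.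
have idJ : ideal_pred (V_Vr A RVr RRn RU) (I_Rn A RVr RRn RU) by apply: ideal_gen_pred.
have mM : monoid_pred (M_neq0 Rneq0).
  by split; [apply: MonoidGen_one|apply: MonoidGen_mul].
have mU : monoid_pred (M_U A RU).
  by split; [apply: MonoidGen_one|apply: MonoidGen_mul].
have [|L [B [phi [hB _ [phiI phiM] [phiV phiJ] phiU]]]] :=
    valuative_nullstellensatz idI mM V_Vr_subring idJ mU I_Rn_sub M_U_sub.
  by move=> m u j i Mm Uu Jj Ii E; apply: noc; exists m, u, j, i.
pose iota : {rmorphism K -> L} := phi \o @mpolyC r K.
have evE p : (map_mpoly iota p).@[fun i => phi 'X_i] = phi p.
  exact: mpoly_rmorph_eval.
exists L, B, iota, (fun i => phi 'X_i); split=> //.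
  move=> a; apply/idP/idP => [aB|aA]; last first.
    by apply: phiV; apply: SubringGen_gen; constructor 4; exists a.
  apply: contraT => nA; have am := vring_notin hA nA.
  have a0 : a != 0 by apply: contraNneq nA => ->; apply: vring0.
  have : iota a^-1 \in val_max B by apply: phiJ; apply: IdealGen_gen; right;
    exists a^-1.
  move=> /(vmaxMl hB aB); rewrite -rmorphM divff // rmorph1.
  by rewrite (negPf (vmax1 hB)).
split=> p pR /=; rewrite evE.
- by apply: phiI; apply: IdealGen_gen.
- by apply: phiM; apply: MonoidGen_gen.
- by apply: phiV; apply: SubringGen_gen; constructor 1.
- by apply: phiU; apply: MonoidGen_gen; left.
- by apply: phiJ; apply: IdealGen_gen; left.
Qed.

Theorem point_no_certificate (L : fieldType) (B : {pred L})
    (iota : {rmorphism K -> L}) (x : 'I_r -> L) :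
    valuation_ring B -> (forall a, (iota a \in B) = (a \in A)) ->
    solution_set B iota Req0 Rneq0 RVr RRn RU x ->
  ~ certificate A Req0 Rneq0 RVr RRn RU.
Proof.
move=> hB hAB [h1 h2 h3 h4 h5] [m [u [j [i [Mm Uu Jj Ii]]]]].
pose ev : {rmorphism {mpoly K[r]} -> L} := meval x \o map_mpoly iota.
have evC c : ev c%:MP = iota c by rewrite /= map_mpolyC mevalC.
have evI : ev i = 0.
  elim: Ii => [p /h1//||p q _ IHp _ IHq|c p _ _ IHp]; first exact: rmorph0.
    by rewrite rmorphD IHp IHq addr0.
  by rewrite rmorphM IHp mulr0.
have evM : ev m != 0.
  elim: Mm => [p /h2//||p q _ IHp _ IHq]; first by rewrite rmorph1 oner_neq0.
  by rewrite rmorphM mulf_neq0.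
have evV p : V_Vr A RVr RRn RU p -> ev p \in B.
  elim=> {p} [p [/h3//|/h5/vmax_vring//|/h4/vunit_vring//|[c cA ->]]||
      p q _ IHp _ IHq|p q _ IHp _ IHq].
  - by rewrite evC hAB.
  - by rewrite rmorph1 vring1.
  - by rewrite rmorphB vringB.
  - by rewrite rmorphM vringM.
have evJ : ev j \in val_max B.
  elim: Jj => [p [/h5//|[c cm ->]]||p q _ IHp _ IHq|c p /evV cB _ IHp].
  - by rewrite evC (ext_max hAB).
  - by rewrite rmorph0 vmax0.
  - by rewrite rmorphD vmaxD.
  - by rewrite rmorphM vmaxMl.
have evU : ev u \in val_unit B.
  elim: Uu => [p [/h4//|[c cU ->]]||p q _ IHp _ IHq].
  - by rewrite evC (ext_unit hAB).
  - by rewrite rmorph1 vunit1.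
  - by rewrite rmorphM vunitM.
move/(congr1 ev); rewrite rmorph0 rmorphD rmorphM rmorphD evI addr0.
by apply/eqP; rewrite mulf_neq0 // (vunit_neq0 (vunitDmax hB evU evJ)).
Qed.

End Certificates.

(** * Linear systems with valuation constraints *)

(** The constraints on the coefficients of a certificate: the coefficient of u is a
    unit, those of j are integral or in the maximal ideal according to the generators
    of I_Rn involved, and those of i are free. *)
Variant coef_kind := Unit | Integral | Maximal | Free.

HB.instance Definition _ := gen_eqMixin coef_kind.

Definition constrained (k : coef_kind) : bool := if k is Free then false else true.

Definition kind_in (K : fieldType) (A : {pred K}) (k : coef_kind) : {pred K} :=
  match k with
  | Unit => val_unit A | Integral => A | Maximal => val_max A | Free => predT
  end.

(** Ranks do not change under field extension: a relation over K' gives one over K,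
    and columns of a diagonal matrix added to W force the support. *)
Lemma relation_support (K K' : fieldType) (iota : {rmorphism K -> K'})
    (n N : nat) (W : 'M[K]_(n, N)) (c : 'rV[K']_n) :
    c != 0 -> c *m map_mx iota W = 0 ->
  exists l : 'rV[K]_n,
    [/\ l != 0, l *m W = 0 & forall i, c 0 i = 0 -> l 0 i = 0].
Proof.
move=> c0 cW.
pose D : 'M[K]_n := diag_mx (\row_i (c 0 i == 0)%:R).
have mulD (E : fieldType) (f : {rmorphism K -> E}) (x : 'rV[E]_n) i :
    (x *m map_mx f D) 0 i = x 0 i * (c 0 i == 0)%:R.
  by rewrite map_diag_mx mul_mx_diag !mxE rmorph_nat.
have nfree : kermx (row_mx W D) != 0.
  rewrite kermx_eq0 -(row_free_map iota) map_row_mx; apply/negP => /row_free_inj.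
  move=> inj; case/eqP: c0; apply: (inj _ c 0); rewrite mul0mx mul_mx_row cW.
  rewrite -[RHS]row_mx0; congr row_mx; apply/rowP => i; rewrite mulD mxE.
  by case: eqP => [->|_]; rewrite ?mul0r ?mulr0.
have [l /sub_kermxP + l0] := rowV0Pn nfree.
rewrite mul_mx_row -[0](row_mx0 _ 1 N n) => /eq_row_mx[lW lD].
exists l; split=> // i ci; have := mulD K idfun l i.
by rewrite map_mx_id // lD mxE ci eqxx mulr1.
Qed.

Section LinearDescent.
Variables (K K' : fieldType) (A : {pred K}) (A' : {pred K'}).
Variable iota : {rmorphism K -> K'}.
Hypotheses (hA : valuation_ring A) (hA' : valuation_ring A').
Hypothesis hAA' : forall a, (iota a \in A') = (a \in A).
Variables (n N : nat) (W : 'M[K]_(n, N)) (tag : 'I_n -> coef_kind) (i0 : 'I_n).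
Hypotheses (tag0 : tag i0 = Unit) (tagU : forall i, tag i = Unit -> i = i0).

(** By induction on the support of the solution c over K'.  A relation l over K with
    support in that of c either is, up to a scalar, a solution over K, or can be
    subtracted from c, after scaling, to kill the coefficient at a pivot p: one where
    l is largest among the constrained coefficients, or any one with l_p nonzero if l
    vanishes on them.  Ties are broken in favour of the Maximal coefficients, then
    of the Unit one: so l_i / l_p is in the maximal ideal whenever the constraint at
    i would not survive the subtraction of an integral multiple of a unit. *)
Lemma linear_descent (c : 'rV[K']_n) :
    c *m map_mx iota W = 0 -> (forall i, c 0 i \in kind_in A' (tag i)) ->
  exists l : 'rV[K]_n, l *m W = 0 /\ forall i, l 0 i \in kind_in A (tag i).
Proof.
have [s] := ubnP #|[set i | c 0 i != 0]|; elim: s c => // s IH c le_s cW ck.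
have ci0 : c 0 i0 != 0 by have := ck i0; rewrite tag0; apply: vunit_neq0.
have c0 : c != 0 by apply/eqP => c0; rewrite c0 mxE eqxx in ci0.
have [l [l0 lW lc]] := relation_support c0 cW.
have cA i : constrained (tag i) -> c 0 i \in A'.
  by have := ck i; case: (tag i) => // [/vunit_vring|/vmax_vring].
(* Subtracting from c the multiple of l that cancels its coefficient at p
   enlarges the set of zeros of c; only the constraints have to be checked. *)
have eliminate p : l 0 p != 0 ->
    (forall i, c 0 i - c 0 p * iota (l 0 i / l 0 p) \in kind_in A' (tag i)) ->
  exists l : 'rV[K]_n, l *m W = 0 /\ forall i, l 0 i \in kind_in A (tag i).
  move=> lp c'k; pose c' := c - (c 0 p / iota (l 0 p)) *: map_mx iota l.
  have c'E i : c' 0 i = c 0 i - c 0 p * iota (l 0 i / l 0 p).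
    by rewrite !mxE fmorph_div mulrAC mulrA.
  apply: (IH c') => [||i]; last by rewrite c'E.
  - rewrite -ltnS; apply: leq_trans le_s; rewrite ltnS; apply: proper_card.
    apply/properP; split.
      apply/fintype.subsetP => i; rewrite !inE c'E; apply: contraNneq => ci.
      by rewrite ci lc // mul0r rmorph0 mulr0 subr0.
    exists p; rewrite inE; last by rewrite c'E divff // rmorph1 mulr1 subrr eqxx.
    by apply: contraNneq lp => /lc->.
  - by rewrite mulmxBl cW -scalemxAl -map_mxM lW map_mx0 scaler0 subr0.
pose T := [seq i <- enum 'I_n | constrained (tag i)].
have inT i : (i \in T) = constrained (tag i) by rewrite mem_filter mem_enum andbT.
have [/hasP[i1 i1T li1]|/hasPn lT] := boolP (has (fun i => l 0 i != 0) T); last first.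
  (* Only unconstrained coefficients are involved in l. *)
  have [p lp] : exists p, l 0 p != 0.
    by have [z [p lp]] := matrix0Pn l l0; exists p; rewrite -(ord1 z).
  apply: (eliminate p) => // i.
  have [iT|] := boolP (i \in T); last first.
    by rewrite inT; have := ck i; case: (tag i).
  by have := lT _ iT; rewrite negbK => /eqP->; rewrite mul0r rmorph0 mulr0 subr0.
have [|p [pT lp pmax]] := vring_pivot hA (f := fun i => l 0 i) (s := T).
  by exists i1.
have lpA i : constrained (tag i) -> l 0 i / l 0 p \in A by rewrite -inT => /pmax.
have [[k [tagk lk kmax]]|nmax] := pselect (exists k, [/\ tag k = Maximal,
    l 0 k != 0 & forall i, constrained (tag i) -> l 0 i / l 0 k \in A]).
  apply: (eliminate k) => // i.
  have ckm : c 0 k \in val_max A' by have := ck k; rewrite tagk.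
  have lki : constrained (tag i) -> - (c 0 k * iota (l 0 i / l 0 k)) \in val_max A'.
    by move=> /kmax h; apply: vmaxN => //; apply: vmaxMr => //; rewrite hAA'.
  have := ck i; case: (tag i) lki => //= /(_ isT) lki ci.
  - exact: vunitDmax.
  - by apply: vringD => //; apply: vmax_vring.
  - exact: vmaxD.
have lpm i : tag i = Maximal -> l 0 i / l 0 p \in val_max A.
  move=> tagi; apply: contraT => nm; case: nmax; exists i.
  have := vunitI (lpA i _) nm; rewrite tagi => /(_ isT) lU.
  have li : l 0 i != 0 by have := vunit_neq0 lU; rewrite mulf_eq0 => /norP[].
  split=> // m tm; have := vunit_vring (vunitV lU); rewrite invf_div => pi.
  by rewrite -[l 0 m](divfK lp) -[X in X \in _]mulrA vringM ?lpA.
have [l0m|l0m] := boolP (l 0 i0 / l 0 p \in val_max A).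
  have lpp : l 0 p / l 0 p \notin val_max A by rewrite divff ?vmax1.
  have cpA : c 0 p \in A' by apply: cA; rewrite -inT.
  apply: (eliminate p) => // i.
  have := ck i; case tagi: (tag i) => //= ci.
  - rewrite (tagU tagi) in ci *; apply: vunitDmax => //.
    by apply: vmaxN => //; apply: vmaxMl => //; rewrite (ext_max hAA').
  - by apply: vringB => //; apply: vringM => //; rewrite hAA' lpA // tagi.
  - apply: vmaxD => //; apply: vmaxN => //; apply: vmaxMl => //.
    by rewrite (ext_max hAA') lpm.
have l0U : l 0 i0 / l 0 p \in val_unit A.
  by apply: vunitI => //; apply: lpA; rewrite tag0.
have l0n : l 0 i0 != 0 by have := vunit_neq0 l0U; rewrite mulf_eq0 => /norP[].
have lpi : l 0 p / l 0 i0 \in A by have := vunit_vring (vunitV l0U); rewrite invf_div.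
exists ((l 0 i0)^-1 *: l); split; first by rewrite -scalemxAl lW scaler0.
move=> i; rewrite mxE mulrC.
have E : l 0 i / l 0 i0 = l 0 i / l 0 p * (l 0 p / l 0 i0) by rewrite mulrA divfK.
case tagi: (tag i) => //=.
- by rewrite (tagU tagi) divff ?vunit1.
- by rewrite E vringM ?lpA ?tagi.
- by rewrite E vmaxMr ?lpm.
Qed.
End LinearDescent.

(** * Descent of certificates *)

Section CertificateDescent.
Variables (K K' : fieldType) (A : {pred K}) (A' : {pred K'}).
Variable iota : {rmorphism K -> K'}.
Hypotheses (hA : valuation_ring A) (hA' : valuation_ring A').
Hypothesis hAA' : forall a, (iota a \in A') = (a \in A).
Variable r : nat.
Local Notation mp := (@map_mpoly r K K' iota).
Local Notation term F := (coef_kind * F * {mpoly K[r]})%type.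

(** [linear_descent] for the coefficients of a linear relation between
    polynomials, whose rows are the coefficients on the monomials that occur. *)
Lemma poly_descent (s : seq (term K')) (c0 : K') (w0 : {mpoly K[r]}) :
    c0 \in val_unit A' ->
    c0 *: mp w0 + \sum_(e <- s) e.1.2 *: mp e.2 = 0 ->
    (forall e, e \in s -> e.1.1 <> Unit /\ e.1.2 \in kind_in A' e.1.1) ->
  exists (l0 : K) (t : seq (term K)),
    [/\ l0 \in val_unit A, l0 *: w0 + \sum_(e <- t) e.1.2 *: e.2 = 0
      & forall e, e \in t -> e.1.2 \in kind_in A e.1.1 /\
          exists2 e', e' \in s & e'.1.1 = e.1.1 /\ e'.2 = e.2].
Proof.
move=> c0U sum0 sk; pose S : seq (term K') := (Unit, c0, w0) :: s.
pose T (i : 'I_(size S)) := tnth (in_tuple S) i.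
pose ms := flatten [seq (msupp e.2 : seq _) | e <- S].
pose W := \matrix_(i < size S, k < size ms) (T i).2@_(nth 0%MM ms k).
have TS i : T i \in S by apply: mem_tnth.
have T0 : T ord0 = (Unit, c0, w0) by [].
have Tlift (i : 'I_(size s)) : T (lift ord0 i) \in s.
  by rewrite /T (tnth_nth (Unit, c0, w0)) lift0; apply: mem_nth.
have sumT : \sum_(i < size S) (T i).1.2 *: mp (T i).2 = 0.
  rewrite -(big_tnth 0 +%R S xpredT (fun e : term K' => e.1.2 *: mp e.2)).
  by rewrite big_cons.
have msT i m : m \notin ms -> (T i).2@_m = 0.
  move=> mn; apply: memN_msupp_eq0; apply: contra mn => mT.
  by apply/flatten_mapP; exists (T i).
pose tag i := (T i).1.1.
have tagU i : tag i = Unit -> i = ord0.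
  by case: (unliftP ord0 i) => [j ->|-> //] tj; have [/(_ tj)] := sk _ (Tlift j).
have tag0 : tag ord0 = Unit by [].
pose c := \row_i (T i).1.2.
have [||l [lW lk]] := @linear_descent _ _ _ _ _ hA hA' hAA' _ _ W tag _ tag0 tagU c.
- apply/rowP => k; rewrite !mxE.
  have /(congr1 (mcoeff (nth 0%MM ms k))) := sumT.
  rewrite mcoeff0 => E; rewrite -[RHS]E raddf_sum; apply: eq_bigr => i _.
  by rewrite !mxE /= mcoeffZ mcoeff_map_mpoly.
- move=> i; rewrite mxE; case: (unliftP ord0 i) => [j ->|-> //].
  by case: (sk _ (Tlift j)).
have suml : \sum_(i < size S) l 0 i *: (T i).2 = 0.
  apply/mpolyP => m; rewrite mcoeff0 raddf_sum /=.
  have [mms|mms] := boolP (m \in ms); last first.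
    by apply: big1 => i _; rewrite mcoeffZ msT ?mulr0.
  have kP : (index m ms < size ms)%N by rewrite index_mem.
  have := congr1 (fun M : 'rV_(size ms) => M 0 (Ordinal kP)) lW.
  rewrite !mxE => E; rewrite -[RHS]E; apply: eq_bigr => i _.
  by rewrite mcoeffZ !mxE /= nth_index.
exists (l 0 ord0), [seq ((T (lift ord0 i)).1.1, l 0 (lift ord0 i), (T (lift
  ord0 i)).2) |
  i <- enum 'I_(size s)]; split.
- by have := lk ord0.
- by rewrite big_map big_enum /=; move: suml; rewrite big_ord_recl.
- move=> e /mapP[i _ ->] /=; split; first exact: lk.
  by exists (T (lift ord0 i)).
Qed.

(** The span over K' of the polynomials satisfying P, with coefficients restricted
    to one kind. *)
Inductive combination (k : coef_kind) (P : {mpoly K[r]} -> Prop) :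
    {mpoly K'[r]} -> Prop :=
| CombGen c p of c \in kind_in A' k & P p : combination k P (c *: mp p)
| CombZero : combination k P 0
| CombAdd p q of combination k P p & combination k P q :
    combination k P (p + q).

Lemma combination_terms k P p : combination k P p ->
  exists s : seq (term K'),
    p = \sum_(e <- s) e.1.2 *: mp e.2 /\
    forall e, e \in s -> [/\ e.1.1 = k, e.1.2 \in kind_in A' k & P e.2].
Proof.
elim=> {p} [c p ck Pp||p q _ [s [-> sP]] _ [t [-> tP]]].
- exists [:: (k, c, p)]; split; first by rewrite big_seq1.
  by move=> e; rewrite inE => /eqP->.
- by exists [::]; rewrite big_nil.
- exists (s ++ t); rewrite big_cat; split=> // e.
  by rewrite mem_cat => /orP[/sP|/tP].
Qed.

Lemma combinationM k1 k2 k (P1 P2 P : {mpoly K[r]} -> Prop) p q :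
    (forall a b, a \in kind_in A' k1 -> b \in kind_in A' k2 ->
       a * b \in kind_in A' k) ->
    (forall a b, P1 a -> P2 b -> P (a * b)) ->
  combination k1 P1 p -> combination k2 P2 q -> combination k P (p * q).
Proof.
move=> kM PM; elim=> {p} [c p ck Pp||p p' _ IH _ IH'].
- elim=> {q} [d q dk Pq||q q' _ IH _ IH'].
  + rewrite -scalerAl -scalerAr scalerA -rmorphM.
    by apply: CombGen; [apply: kM|apply: PM].
  + by rewrite mulr0; apply: CombZero.
  + by rewrite mulrDr; apply: CombAdd.
- by move=> _; rewrite mul0r; apply: CombZero.
- by move=> qP; rewrite mulrDl; apply: CombAdd; auto.
Qed.

Lemma combinationN k P p :
    (forall a, a \in kind_in A' k -> - a \in kind_in A' k) ->
  combination k P p -> combination k P (- p).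
Proof.
move=> kN; elim=> {p} [c p ck Pp||p q _ IHp _ IHq].
- by rewrite -scaleNr; apply: CombGen; auto.
- by rewrite oppr0; apply: CombZero.
- by rewrite opprD; apply: CombAdd.
Qed.

Variables Req0 Rneq0 RVr RRn RU : seq {mpoly K[r]}.
Local Notation img := (map mp).

Lemma combination_all p : combination Free (fun=> True) p.
Proof.
elim/mpolyind: p => [|c m p _ _ IH]; first exact: CombZero.
by apply: CombAdd => //; rewrite -(map_mpolyX iota); apply: CombGen.
Qed.

Lemma descent_eq0 i : I_eq0 (img Req0) i -> combination Free (I_eq0 Req0) i.
Proof.
elim=> {i} [_ /mapP[p pR ->]||p q _ IHp _ IHq|c p _ _ IHp].
- by rewrite -[mp p]scale1r; apply: CombGen => //; apply: IdealGen_gen.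
- exact: CombZero.
- exact: CombAdd.
- apply: combinationM (combination_all c) IHp => // a b _ Ib.
  exact: IdealGen_mul.
Qed.

Lemma descent_neq0 m : M_neq0 (img Rneq0) m -> exists2 n, M_neq0 Rneq0 n & m = mp n.
Proof.
elim=> {m} [_ /mapP[p pR ->]||p q _ [n nM ->] _ [n' nM' ->]].
- by exists p => //; apply: MonoidGen_gen.
- by exists 1; [apply: MonoidGen_one|rewrite rmorph1].
- by exists (n * n'); [apply: MonoidGen_mul|rewrite rmorphM].
Qed.

Lemma descent_unit u : M_U A' (img RU) u ->
  exists c v, [/\ c \in val_unit A', M_U A RU v & u = c *: mp v].
Proof.
elim=> {u} [_ [/mapP[p pR ->]|[c cU ->]]||
    _ _ _ [c [p [cU Mp ->]]] _ [d [q [dU Mq ->]]]].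
- exists 1, p; split; rewrite ?scale1r ?vunit1 //.
  by apply: MonoidGen_gen; left.
- by exists c, 1; split; rewrite ?rmorph1 -?mul_mpolyC ?mulr1 //; apply: MonoidGen_one.
- by exists 1, 1; split; rewrite ?rmorph1 ?scale1r ?vunit1 //; apply: MonoidGen_one.
- exists (c * d), (p * q); split; first exact: vunitM.
    exact: MonoidGen_mul.
  by rewrite -scalerAl -scalerAr scalerA rmorphM.
Qed.

Lemma descent_Vr v : V_Vr A' (img RVr) (img RRn) (img RU) v ->
  combination Integral (V_Vr A RVr RRn RU) v.
Proof.
have gen p : [\/ p \in RVr, p \in RRn, p \in RU | const_in A p] ->
    combination Integral (V_Vr A RVr RRn RU) (mp p).
  move=> pR; rewrite -[mp p]scale1r; apply: CombGen; first exact: vring1.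
  exact: SubringGen_gen.
elim=> {v} [_ [/mapP[p pR ->]|/mapP[p pR ->]|/mapP[p pR ->]|[c cA ->]]||
    p q _ IHp _ IHq|p q _ IHp _ IHq].
- by apply: gen; constructor 1.
- by apply: gen; constructor 2.
- by apply: gen; constructor 3.
- rewrite -[_%:MP]mulr1 mul_mpolyC -(rmorph1 mp); apply: CombGen => //.
  exact: SubringGen_one.
- rewrite -(rmorph1 mp); apply: gen; constructor 4; exists 1; rewrite ?vring1 //.
- by apply: CombAdd => //; apply: combinationN => // a; apply: vringN.
- apply: combinationM IHp IHq => [a b|a b]; first exact: vringM.
  exact: SubringGen_mul.
Qed.

(** An element of I_Rn over K' is a combination of elements of I_Rn over K with
    integral coefficients, up to the contribution of the maximal ideal of A', which
    that of A need not generate. *)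
Lemma descent_Rn j : I_Rn A' (img RVr) (img RRn) (img RU) j ->
  exists p q, [/\ combination Integral (I_Rn A RVr RRn RU) p,
    combination Maximal (V_Vr A RVr RRn RU) q & j = p + q].
Proof.
elim=> {j} [_ [/mapP[p pR ->]|[c cm ->]]||
    _ _ _ [p [q [Pp Pq ->]]] _ [p' [q' [Pp' Pq' ->]]]|
    c _ /descent_Vr Vc _ [p [q [Pp Pq ->]]]].
- exists (mp p), 0; split; [|exact: CombZero|by rewrite addr0].
  rewrite -[mp p]scale1r; apply: CombGen; first exact: vring1.
  by apply: IdealGen_gen; left.
- exists 0, c%:MP; split; [exact: CombZero| |by rewrite add0r].
  rewrite -[_%:MP]mulr1 mul_mpolyC -(rmorph1 mp); apply: CombGen => //.
  exact: SubringGen_one.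
- by exists 0, 0; split; [apply: CombZero|apply: CombZero|rewrite addr0].
- by exists (p + p'), (q + q'); split; [apply: CombAdd|apply: CombAdd|ring].
- exists (c * p), (c * q); split; last by rewrite mulrDr.
    apply: combinationM Vc Pp => [a b|a b]; first exact: vringM.
    exact: IdealGen_mul.
  apply: combinationM Vc Pq => [a b|a b]; first exact: vmaxMl.
  exact: SubringGen_mul.
Qed.

(** Each ingredient of the certificate over K' is a combination of polynomials over
    K that are admissible in a certificate over K, so that the equality is a linear
    relation to which [poly_descent] applies. *)
Theorem certificate_descent :
  certificate A' (img Req0) (img Rneq0) (img RVr) (img RRn) (img RU) ->
  certificate A Req0 Rneq0 RVr RRn RU.
Proof.
move=> [_ [_ [_ [i' [/descent_neq0[m Mm ->] /descent_unit[c [u [cU Uu ->]]]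
  /descent_Rn[_ [_ [/combination_terms[s1 [-> s1P]] /combination_terms[s2 [->
    s2P]] ->]]]
  /descent_eq0/combination_terms[s3 [-> s3P]] E]]]]].
pose s : seq (term K') := [seq (e.1, m * e.2) | e <- s1 ++ s2] ++ s3.
have [||l [t [lU tE tP]]] := @poly_descent s c (m * u) cU.
- rewrite -[RHS]E /s big_cat big_map big_cat /= rmorphM addrA; congr (_ + _).
  rewrite mulrDr -scalerAr; congr (_ + _).
  rewrite mulrDr !mulr_sumr; congr (_ + _); apply: eq_bigr => e _;
    by rewrite rmorphM scalerAr.
- move=> e; rewrite mem_cat => /orP[/mapP[e' + -> /=]|/s3P[-> ? _] //].
  by rewrite mem_cat => /orP[/s1P|/s2P] [-> ? _].
have kinds e : e \in s -> match e.1.1 with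
    | Unit => False
    | Integral => exists2 p, I_Rn A RVr RRn RU p & e.2 = m * p
    | Maximal => exists2 p, V_Vr A RVr RRn RU p & e.2 = m * p
    | Free => I_eq0 Req0 e.2
    end.
  rewrite mem_cat => /orP[/mapP[e' + -> /=]|/s3P[-> _ ]//].
  by rewrite mem_cat => /orP[/s1P|/s2P] [-> _ ?]; exists e'.2.
have {tP} : exists j i, [/\ I_Rn A RVr RRn RU j, I_eq0 Req0 i
    & \sum_(e <- t) e.1.2 *: e.2 = m * j + i].
  elim: t tP {tE} => [|e t IH] tP.
    exists 0, 0; rewrite big_nil mulr0 addr0.
    by split=> //; apply: IdealGen_zero.
  have [|j [i [Jj Ii tE]]] := IH; first by move=> e' e't; apply: tP;
    rewrite inE e't orbT.
  have [|ek [e' /kinds ke' [E1 E2]]] := tP e; first by rewrite inE eqxx.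
  have Vconst a : a \in A -> V_Vr A RVr RRn RU a%:MP.
    by move=> aA; apply: SubringGen_gen; constructor 4; exists a.
  rewrite big_cons tE -E2; move: ek ke'; rewrite -E1; case: (e'.1.1) => //= ek.
  - move=> [p Jp ->]; exists (e.1.2%:MP * p + j), i; split=> //.
      by apply: IdealGen_add => //; apply: IdealGen_mul => //; apply: Vconst.
    by rewrite -mul_mpolyC; ring.
  - move=> [p Vp ->]; exists (p * e.1.2%:MP + j), i; split=> //.
      apply: IdealGen_add => //; apply: IdealGen_mul => //.
      by apply: IdealGen_gen; right; exists e.1.2.
    by rewrite -mul_mpolyC; ring.
  - move=> Ip; exists j, (e.1.2%:MP * e'.2 + i); split=> //.
      by apply: IdealGen_add => //; apply: IdealGen_mul.
    by rewrite -mul_mpolyC; ring.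
move=> [j [i [Jj Ii tE']]].
exists m, (l%:MP * u), j, i; split=> //.
  by apply: MonoidGen_mul => //; apply: MonoidGen_gen; right; exists l.
by rewrite -[RHS]tE tE' -!mul_mpolyC; ring.
Qed.
End CertificateDescent.

(** * Ultraproducts of algebraically closed valued fields *)

Definition ultrafilter_pred (I : Type) (D : set I -> Prop) : Prop :=
  [/\ forall S, D S -> exists i, S i,
      forall S T, D (S `&` T)%classic <-> D S /\ D T
    & forall S, D (~` S)%classic <-> ~ D S].

(** An ultraproduct of copies of F is obtained from [valuative_nullstellensatz] in
    the ring of functions I -> F, all conditions being understood to hold on a set of
    G; there is no certificate, since it could be evaluated at a point of I.  As
    every function f has a pointwise inverse on the set where f is nonzero, the
    functions already fill the fraction field.  As I splits into a part where f is
    integral and a part where its inverse is in the maximal ideal, the valuation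
    ring consists of the images of the functions that are integral on a large set.
    Roots of monic polynomials are found pointwise. *)
Theorem ultraproduct (F : closedFieldType) (A : {pred F}) (I : pointedType)
    (G : set I -> Prop) :
    valuation_ring A -> G setT ->
    (forall S T, G S -> G T -> G (S `&` T)%classic) ->
    (forall S, G S -> exists i, S i) ->
  exists (M : closedFieldType) (B : {pred M}) (phi : {rmorphism (I -> F) -> M})
      (D : set I -> Prop),
    [/\ valuation_ring B /\ (forall y, exists f, y = phi f),
        ultrafilter_pred D /\ (forall S, G S -> D S),
        (forall f, phi f = 0 <-> D [set i | f i = 0]%classic),
        (forall f, phi f \in B <-> D [set i | f i \in A]%classic)
      & forall f, phi (fun i => (f i)^-1) = (phi f)^-1].
Proof.
move=> hA GT GI Gn.
pose ev (P : F -> Prop) (f : I -> F) := exists2 S, G S & forall i, S i -> P (f i).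
have evP (P : F -> Prop) f : (forall i, P (f i)) -> ev P f by exists setT.
have ev2 (P Q T : F -> Prop) (op : (I -> F) -> (I -> F) -> (I -> F)) (op' : F
  -> F -> F) :
    (forall f g i, op f g i = op' (f i) (g i)) ->
    (forall x y, P x -> Q y -> T (op' x y)) ->
    forall f g, ev P f -> ev Q g -> ev T (op f g).
  move=> opE opP f g [S GS Sf] [S' GS' Sg]; exists (S `&` S')%classic; first exact: GI.
  by move=> i [Si Si']; rewrite opE; apply: opP; auto.
have := @valuative_nullstellensatz (I -> F : comNzRingType) (ev (fun x => x = 0))
  (ev (fun x => x != 0)) (ev (fun x => x \in A)) (ev (fun x => x \in val_max A))
  (ev (fun x => x \in val_unit A)).
case.
- split; first exact: evP.
    by apply: (ev2 _ _ _ _ +%R) => // x y -> ->; rewrite addr0.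
  move=> c x _ [S GS Sx]; exists S => // i /Sx xi.
  by rewrite mulrfctE xi mulr0.
- split; first by apply: evP => i; apply: oner_neq0.
  by apply: (ev2 _ _ _ _ *%R) => // x y; apply: mulf_neq0.
- split; first by apply: evP => i; apply: vring1.
    by apply: (ev2 _ _ _ _ (fun x y => x - y)) => // x y; apply: vringB.
  by apply: (ev2 _ _ _ _ *%R) => // x y; apply: vringM.
- split; first by apply: evP => i; apply: vmax0.
    by apply: (ev2 _ _ _ _ +%R) => // x y; apply: vmaxD.
  by apply: (ev2 _ _ _ _ *%R) => // x y; apply: vmaxMl.
- split; first by apply: evP => i; apply: vunit1.
  by apply: (ev2 _ _ _ _ *%R) => // x y; apply: vunitM.
- by move=> f [S GS Sf]; exists S => // i /Sf/vmax_vring.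
- by move=> f [S GS Sf]; exists S => // i /Sf/vunit_vring.
- move=> m u j z mM uU jJ zI E.
  have uj : ev (fun x => x \in val_unit A) (u + j).
    by move: uU jJ; apply: (ev2 _ _ _ _ +%R) => // x y; apply: vunitDmax.
  have muj : ev (fun x => x != 0) (m * (u + j)).
    by move: mM uj; apply: (ev2 _ _ _ _ *%R) => // x y x0 /vunit_neq0; apply: mulf_neq0.
  have : ev (fun x => x != 0) (m * (u + j) + z).
    by move: muj zI; apply: (ev2 _ _ _ _ +%R) => // x y x0 ->; rewrite addr0.
  rewrite E => -[S GS S0]; have [i Si] := Gn _ GS.
  by have /eqP := S0 i Si.
move=> L [B [phi [hB fracs [phi0 phi_neq0] [phiV phiJ] _]]].
(* The image of the indicator function of S tells whether S is large. *)
pose ind (S : set I) : I -> F := fun i => (`[< S i >])%:R.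
have indT (S : set I) i : S i -> ind S i = 1 by move=> Si; rewrite /ind asboolT.
have indF (S : set I) i : ~ S i -> ind S i = 0 by move=> Si; rewrite /ind asboolF.
pose D (S : set I) := phi (ind S) = 1.
have indI S T : ind (S `&` T)%classic = ind S * ind T.
  apply/funext => i; rewrite mulrfctE; have [Si|Si] := pselect (S i).
    rewrite (indT _ _ Si) mul1r; have [Ti|Ti] := pselect (T i).
      by rewrite !indT.
    by rewrite !indF // => -[].
  by rewrite !(indF _ _ Si) mul0r indF // => -[].
have indC S : ind (~` S)%classic = 1 - ind S.
  apply/funext => i; change (ind (~` S)%classic i = 1 - ind S i).
  have [Si|Si] := pselect (S i).
    by rewrite (indT _ _ Si) subrr indF.
  by rewrite (indF _ _ Si) subr0 indT.
have ind01 S : phi (ind S) = 1 \/ phi (ind S) = 0.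
  have : phi (ind S) * phi (ind (~` S)%classic) = 0.
    rewrite -rmorphM -indI; have -> : ind (S `&` ~` S)%classic = 0.
      by apply/funext => i; rewrite indF // => -[].
    exact: rmorph0.
  move/eqP; rewrite mulf_eq0 => /orP[/eqP->|]; first by right.
  by rewrite indC rmorphB rmorph1 subr_eq0 => /eqP <-; left.
have one0 : (1 : L) <> 0 by apply/eqP/oner_neq0.
have DC S : D (~` S)%classic <-> ~ D S.
  rewrite /D indC rmorphB rmorph1; split.
    by move=> E DS; rewrite DS subrr in E; case: one0.
  by case: (ind01 S) => // -> _; rewrite subr0.
have DI S T : D (S `&` T)%classic <-> D S /\ D T.
  rewrite /D indI rmorphM; split; last by case=> -> ->; rewrite mulr1.
  by case: (ind01 S) => ->; rewrite ?mul0r ?mul1r // => E; case: one0.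
have DG S : G S -> D S.
  move=> GS; have : phi (ind S - 1) = 0.
    apply: phi0; exists S => // i Si.
    by change (ind S i - 1 = 0); rewrite indT // subrr.
  by rewrite rmorphB rmorph1 => /eqP; rewrite subr_eq0 => /eqP.
have Dn S : D S -> exists i, S i.
  move=> DS; apply: contrapT => nS; apply: one0; rewrite -DS.
  have -> : ind S = 0; last exact: rmorph0.
  by apply/funext => i; rewrite indF // => Si; apply: nS; exists i.
have DU : ultrafilter_pred D by [].
(* Functions agreeing on a large set have the same image. *)
have phiD f g S : D S -> (forall i, S i -> f i = g i) -> phi f = phi g.
  move=> DS fg; rewrite -[phi f]mulr1 -[phi g]mulr1 -DS -!rmorphM.
  congr (phi _); apply/funext => i; rewrite !mulrfctE.
  have [Si|Si] := pselect (S i); first by rewrite fg.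
  by rewrite indF // !mulr0.
pose inv (f : I -> F) : I -> F := fun i => (f i)^-1.
have phi_eq0 f : phi f = 0 <-> D [set i | f i = 0]%classic.
  split; last by move=> DZ; rewrite (@phiD f 0 _ DZ) ?rmorph0.
  move=> f0; apply: contrapT => /DC nD; apply: one0.
  rewrite -(rmorph1 phi) -(@phiD (f * inv f) 1 _ nD); last first.
    by move=> i /= /eqP fi; rewrite mulrfctE mulfV.
  by rewrite rmorphM f0 mul0r.
have phiVE f : phi (inv f) = (phi f)^-1.
  have [/phi_eq0 D0|n0] := pselect (phi f = 0).
    have -> : phi f = 0 by apply/phi_eq0.
    rewrite invr0 (@phiD (inv f) 0 _ D0) ?rmorph0 // => i /= fi.
    by rewrite /inv fi invr0.
  have /DC nD : ~ D [set i | f i = 0]%classic by move/phi_eq0.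
  have f0 : phi f != 0 by apply/eqP.
  apply: (mulfI f0); rewrite divff // -rmorphM -(rmorph1 phi).
  by apply: phiD nD _ => i /= /eqP fi; rewrite mulrfctE mulfV.
have phiB f : phi f \in B <-> D [set i | f i \in A]%classic.
  split=> [fB|DA].
    apply: contrapT => /DC nD; have : 1 \in val_max B; last first.
      by apply/negP/vmax1.
    pose g := inv f * ind (~` [set i | f i \in A])%classic.
    have gJ : phi g \in val_max B.
      apply: phiJ; apply: evP => i; rewrite /g mulrfctE.
      have [fi|fi] := boolP (f i \in A).
        by rewrite indF ?mulr0 ?vmax0 //= => h; apply: h.
      by rewrite indT ?mulr1 ?vring_notin //=; apply/negP.
    rewrite -(rmorph1 phi) -(@phiD (f * g) 1 _ nD).
      by rewrite (rmorphM phi f g); apply: vmaxMl.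
    move=> i /= /negP fi; rewrite /g !mulrfctE indT //=; last exact/negP.
    rewrite mulr1 mulfV //; apply: contraNneq fi => ->; exact: vring0.
  rewrite (@phiD f (f * ind [set i | f i \in A]%classic) _ DA); last first.
    by move=> i /= fi; rewrite mulrfctE indT ?mulr1.
  apply: phiV; apply: evP => i; rewrite mulrfctE.
  have [fi|fi] := boolP (f i \in A); first by rewrite indT ?mulr1.
  by rewrite indF ?mulr0 ?vring0 //=; apply/negP.
have surj y : exists f, y = phi f.
  have [a [b [b0 ->]]] := fracs y.
  by exists (a * inv b); rewrite rmorphM phiVE.
have closed : GRing.closed_field_axiom L.
  move=> n P n_gt0; have [p pP] := choice (fun k => surj (P k)).
  have root i : exists x : F, x ^+ n = \sum_(k < n) p k i * x ^+ k.
    exact: (solve_monicpoly (fun k => p k i)).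
  have [x xP] := choice root; exists (phi x).
  rewrite -rmorphXn; under eq_bigr do rewrite pP -rmorphXn -rmorphM.
  rewrite -rmorph_sum; congr (phi _); apply/funext => i.
  by rewrite exprfctE xP fct_sumE; apply: eq_bigr => k _; rewrite mulrfctE exprfctE.
pose L' : fieldType := HB.pack (GRing.Field.sort L) (GRing.Field.class L).
pose closedL := Field_isAlgClosed.Build L' closed.
pose M := HB.pack_for closedFieldType (GRing.Field.sort L) L' closedL.
by exists M, B, phi, D; split.
Qed.

Section Ultrafilter.
Variables (I : Type) (D : set I -> Prop).
Hypothesis hD : ultrafilter_pred D.

Lemma ultraT : D setT.
Proof.
have [Dn _ DC] := hD; rewrite -setC0; apply/DC => /Dn[i []].
Qed.

Lemma ultraS (S T : set I) : (forall i, S i -> T i) -> D S -> D T.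
Proof.
have [_ DI _] := hD; move=> ST DS; have /DI[_] // : D (S `&` T)%classic.
suff -> : (S `&` T)%classic = S by [].
by apply/seteqP; split=> i /=; [case|split; auto].
Qed.

Lemma ultra_all (X : eqType) (R : seq X) (P : X -> set I) :
  {in R, forall n, D (P n)} -> D [set i | {in R, forall n, P n i}]%classic.
Proof.
have [_ DI _] := hD; elim: R => [|n R IH] RP.
  by apply: ultraS ultraT => i _ n.
have DR : D [set i | {in R, forall n, P n i}]%classic.
  by apply: IH => k kR; apply: RP; rewrite inE kR orbT.
have /DI : D (P n) /\ D [set i | {in R, forall n, P n i}]%classic.
  by split=> //; apply: RP; rewrite mem_head.
by apply: ultraS => i [Pn PR] k; rewrite inE => /predU1P[->//|/PR].
Qed.

End Ultrafilter.

(** A system is a finite conjunction of conditions, each of which holds at the class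
    of a family only if it holds on a large set; finitely many large sets have a
    common point. *)
Lemma los (F M : fieldType) (A : {pred F}) (B : {pred M}) (I : pointedType)
    (phi : (I -> F) -> M) (D : set I -> Prop) (X : eqType) (pt : X -> I -> F)
    (Req0 Rneq0 RVr RRn RU : seq X) :
    ultrafilter_pred D ->
    (forall f, phi f = 0 <-> D [set i | f i = 0]%classic) ->
    (forall f, phi f \in B <-> D [set i | f i \in A]%classic) ->
    (forall f, phi (fun i => (f i)^-1) = (phi f)^-1) ->
    satisfies B (fun p => phi (pt p)) Req0 Rneq0 RVr RRn RU ->
  exists i, satisfies A (fun p => pt p i) Req0 Rneq0 RVr RRn RU.
Proof.
move=> hD phi0 phiB phiV [h1 h2 h3 h4 h5]; have [Dn DI DC] := hD.
have D0 f : phi f != 0 <-> D [set i | f i != 0]%classic.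
  split=> [/eqP f0|Df].
    have /DC : ~ D [set i | f i = 0]%classic by move/phi0.
    by apply: (ultraS hD) => i /= /eqP.
  apply/eqP => /phi0 f0; have /Dn[i] : D ([set i | f i = 0] `&` [set i | f i !=
    0])%classic.
    exact/DI.
  by case=> /= ->; rewrite eqxx.
have DU f : phi f \in val_unit B <-> D [set i | f i \in val_unit A]%classic.
  split=> [/and3P[/D0 f0 /phiB fB]|Df].
    rewrite -phiV => /phiB fV; have /DI : _ /\ _ := conj fB fV.
    move=> DBV; have /DI : _ /\ _ := conj f0 DBV.
    by apply: (ultraS hD) => i /= [? [? ?]]; apply/and3P.
  apply/and3P; split; first by apply/D0; apply: ultraS Df => // i /=; apply: vunit_neq0.
    by apply/phiB; apply: ultraS Df => // i /=; apply: vunit_vring.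
  by rewrite -phiV; apply/phiB; apply: ultraS Df => // i /= /and3P[].
have Dm f : phi f \in val_max B -> D [set i | f i \in val_max A]%classic.
  move=> /andP[/phiB fB nU]; have /DC Dn' : ~ D [set i | f i \in val_unit A]%classic.
    by move/DU; apply/negP.
  have /DI : _ /\ _ := conj fB Dn'.
  by apply: (ultraS hD) => i /= [iA iU]; apply/andP; split=> //; apply/negP.
have D1 : D [set i | {in Req0, forall n, pt n i = 0}]%classic.
  by apply: (ultra_all hD) => n /h1/phi0.
have D2 : D [set i | {in Rneq0, forall n, pt n i != 0}]%classic.
  by apply: (ultra_all hD (P := fun n => [set i | pt n i != 0])%classic) => n /h2/D0.
have D3 : D [set i | {in RVr, forall n, pt n i \in A}]%classic.
  by apply: (ultra_all hD (P := fun n => [set i | pt n i \in A])%classic) => n /h3/phiB.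
have D4 : D [set i | {in RU, forall n, pt n i \in val_unit A}]%classic.
  by apply: (ultra_all hD (P := fun n => [set i | pt n i \in val_unit
    A])%classic) => n /h4/DU.
have D5 : D [set i | {in RRn, forall n, pt n i \in val_max A}]%classic.
  by apply: (ultra_all hD (P := fun n => [set i | pt n i \in val_max
    A])%classic) => n /h5/Dm.
have DD S T : D S -> D T -> D (S `&` T)%classic by move=> DS DT; apply/DI.
have [i [p1 [p2 [p3 [p4 p5]]]]] :=
  Dn _ (DD _ _ D1 (DD _ _ D2 (DD _ _ D3 (DD _ _ D4 D5)))).
by exists i.
Qed.

(** * Approximation of a transcendental element *)

Lemma closed_nth_root (F : closedFieldType) n (a : F) :
  exists x, x ^+ n.+1 = a.
Proof.
have [x xE] := solve_monicpoly (fun k => if k == 0 then a else 0) (ltn0Sn n).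
exists x; rewrite xE big_ord_recl /= expr0 mulr1 big1 ?addr0 // => i _.
by rewrite mul0r.
Qed.

(** The residue field of an algebraically closed valued field is infinite: a root y
    of the product of the X - x, minus 1, is integral over A, and the y - x are
    integral with product 1. *)
Lemma residue_avoid (F : closedFieldType) (A : {pred F}) (s : seq F) :
    valuation_ring A -> s != [::] -> {in s, forall x, x \in A} ->
  exists2 y, y \in A & {in s, forall x, y - x \in val_unit A}.
Proof.
move=> hA s0 sA.
have [y] : exists y, root (\prod_(x <- s) ('X - x%:P) - 1) y.
  apply/closed_rootP; rewrite size_polyDl ?size_prod_XsubC ?size_polyN ?size_poly1.
    by case: s s0 {sA}.
  by rewrite ltnS lt0n size_eq0.
rewrite rootE hornerD hornerN hornerC horner_prod subr_eq0 => /eqP.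
under eq_bigr do rewrite hornerXsubC.
move=> prod1.
have prod_in (f : F -> F) (r : seq F) : {in r, forall x, f x \in A} -> \prod_(x
  <- r) f x \in A.
  move=> fA; rewrite big_seq; elim/big_ind: _ => [||x xr];
    [exact: vring1|exact: vringM|exact: fA].
have yA : y \in A.
  apply: contraT => yA; have m1 := vmax1 hA.
  have inv_max : {in s, forall x, (y - x)^-1 \in val_max A}.
    move=> x xs; apply: vring_notin => //; apply: contra yA => yxA.
    by rewrite -[y](subrK x); apply: vringD => //; apply: sA.
  case: s s0 {sA} prod1 inv_max => // x s _ prod1 inv_max.
  move: m1; rewrite -invr1 -prod1 -prodfV big_cons vmaxMr ?inv_max ?mem_head //.
  by apply: prod_in => z zs; apply: vmax_vring; apply: inv_max; rewrite inE zs orbT.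
exists y => // x xs; apply/val_unitP; split; first by apply: vringB => //; apply: sA.
exists (\prod_(z <- rem x s) (y - z)); last by rewrite -[RHS]prod1 [RHS](big_rem x xs).
by apply: prod_in => z /mem_rem/sA; apply: vringB.
Qed.

Section Approximation.
Variables (F : closedFieldType) (L : fieldType) (A : {pred F}) (B : {pred L}).
Variable iota : {rmorphism F -> L}.
Hypotheses (hA : valuation_ring A) (hB : valuation_ring B).
Hypothesis hAB : forall a, (iota a \in B) = (a \in A).
Hypothesis ntA : exists y, y \notin A.

(** The values of x and y have the same sign. *)
Definition same_class (x : L) (y : F) : Prop :=
  (x \in B) = (y \in A) /\ (x^-1 \in B) = (y^-1 \in A).

Lemma same_class_unit u v c : u \in val_unit B -> v \in val_unit A ->
  same_class (u * iota c) (v * c).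
Proof.
move=> uU vU; split; first by rewrite !vring_unitMl.
by rewrite !invfM !vring_unitMl ?vunitV // -fmorphV.
Qed.

Lemma same_class_max x y : x != 0 -> y != 0 ->
  x \in val_max B -> y \in val_max A -> same_class x y.
Proof.
move=> x0 y0 xm ym; split; first by rewrite (vmax_vring xm) (vmax_vring ym).
by rewrite (negPf (vmax_notin hB x0 xm)) (negPf (vmax_notin hA y0 ym)).
Qed.

Lemma same_classV x y : same_class x^-1 y^-1 -> same_class x y.
Proof. by case; rewrite !invrK. Qed.

Lemma same_class_unitM u v x y : u \in val_unit B -> v \in val_unit A ->
  same_class x y -> same_class (u * x) (v * y).
Proof.
by move=> uU vU [E1 E2]; split; rewrite ?invfM !vring_unitMl ?vunitV.
Qed.

(** The value group of F is divisible and nontrivial, so that each finite part of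
    the cut defined by t is realised in F: between the largest lower value c1 and
    the smallest upper value c2, take a square root of c1 c2; when there is no c1 or
    no c2, one is made up from an element of the maximal ideal. *)
Lemma fill_cut (t : L) (s : seq F) :
    t != 0 -> {in s, forall c, c != 0} ->
  exists2 t', t' != 0 & {in s, forall c,
    (iota c / t \in val_max B -> c / t' \in val_max A) /\
    (t / iota c \in val_max B -> t' / c \in val_max A)}.
Proof.
move=> t0 s0.
have [w wm w0] : exists2 w, w \in val_max A & w != 0.
  have [y yA] := ntA; exists y^-1; first exact: vring_notin.
  by rewrite invr_eq0; apply: contraNneq yA => ->; rewrite vring0.
pose low := [seq c <- s | iota c / t \in val_max B].
pose upp := [seq c <- s | t / iota c \in val_max B].
have in_low c : (c \in low) = (iota c / t \in val_max B) && (c \in s) by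
  rewrite mem_filter.
have in_upp c : (c \in upp) = (t / iota c \in val_max B) && (c \in s) by
  rewrite mem_filter.
have max_low : low != [::] -> exists2 c1, c1 \in low & {in low, forall c, c / c1 \in A}.
  case E: low => [//|c l] _; have [|c1 [c1l _ c1P]] := vring_pivot hA (f :=
    id) (s := low).
    have cl : c \in low by rewrite E mem_head.
    by exists c => //; apply: s0; move: cl; rewrite in_low => /andP[].
  by rewrite -E; exists c1.
have min_upp : upp != [::] -> exists2 c2, c2 \in upp & {in upp, forall c, c2 / c \in A}.
  case E: upp => [//|c l] _; have [|c2 [c2l _ c2P]] := vring_pivot hA (f :=
    GRing.inv) (s := upp).
    have cl : c \in upp by rewrite E mem_head.
    by exists c => //; rewrite invr_eq0; apply: s0; move: cl; rewrite in_upp => /andP[].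
  rewrite -E; exists c2 => // z zl; have := c2P z zl; rewrite invrK mulrC; exact.
have [c1 [c2 [c10 c20 c12 c1P c2P]]] : exists c1 c2, [/\ c1 != 0, c2 != 0,
    c1 / c2 \in val_max A, {in low, forall c, c / c1 \in A} &
    {in upp, forall c, c2 / c \in A}].
  have [low0|/max_low[c1 c1l c1P]] := eqVneq low [::].
    have [upp0|/min_upp[c2 c2u c2P]] := eqVneq upp [::].
      by exists w, 1; rewrite divr1 oner_neq0 low0 upp0.
    have c20 : c2 != 0 by apply: s0; move: c2u; rewrite in_upp => /andP[].
    by exists (c2 * w), c2; rewrite mulf_neq0 // mulrC mulKf // low0.
  have c10 : c1 != 0 by apply: s0; move: c1l; rewrite in_low => /andP[].
  have [upp0|/min_upp[c2 c2u c2P]] := eqVneq upp [::].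
    by exists c1, (c1 / w); rewrite mulf_neq0 ?invr_eq0 // invf_div mulrC divfK // upp0.
  have c20 : c2 != 0 by apply: s0; move: c2u; rewrite in_upp => /andP[].
  exists c1, c2; split=> //; rewrite -(ext_max hAB) fmorph_div.
  move: c1l c2u; rewrite in_low in_upp => /andP[c1t _] /andP[tc2 _].
  by rewrite -[iota c1](divfK t0) -[X in X \in _]mulrA; apply: vmaxMr (vmax_vring tc2).
have [t' t'E] := closed_nth_root 1 (c1 * c2).
have t'0 : t' != 0.
  by have : t' ^+ 2 != 0; [rewrite t'E mulf_neq0|rewrite expf_eq0].
have c1t' : c1 / t' \in val_max A.
  apply: (@vmaxXK _ _ hA 1); rewrite expr_div_n t'E.
  by have -> : c1 ^+ 2 / (c1 * c2) = c1 / c2 by field; rewrite c10 c20.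
have t'c2 : t' / c2 \in val_max A.
  apply: (@vmaxXK _ _ hA 1); rewrite expr_div_n t'E.
  by have -> : c1 * c2 / c2 ^+ 2 = c1 / c2 by field.
exists t' => // c cs; split=> ct.
  have cl : c \in low by rewrite in_low ct.
  by rewrite -[c](divfK c10) -[X in X \in _]mulrA vmaxMl ?c1P.
have cu : c \in upp by rewrite in_upp ct.
by rewrite -[t'](divfK c20) -[X in X \in _]mulrA vmaxMr ?c2P.
Qed.

(** Let a0 be a centre closest to t.  If t - a0 has the same value as some b in F,
    then every |t - a| is the maximum of |b| and |a - a0|, and a0 + b y has the same
    property when the residue of y avoids those of the (a - a0) / b.  Otherwise the
    value of t - a is that of a - a0 or that of t - a0, and it is enough to place
    the value of t' - a0 in the right cut. *)
Lemma approximate (t : L) (s : seq (F * F)) :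
    (forall a, t != iota a) -> {in s, forall e, e.2 != 0} ->
  exists t', {in s, forall e, t' != e.1 /\
    same_class ((t - iota e.1) / iota e.2) ((t' - e.1) / e.2)}.
Proof.
move=> tF s2; have [->|s_neq0] := eqVneq s [::]; first by exists 0.
have tB a : t - iota a != 0 by rewrite subr_eq0.
have [|e0 [e0s _ e0P]] := vring_pivot hB (f :=
  fun e : F * F => (t - iota e.1)^-1) (s := s).
  by case: s s_neq0 {s2} => // e s _; exists e; rewrite ?mem_head ?invr_eq0.
pose a0 := e0.1; pose tau := t - iota a0.
have tau0 : tau != 0 by apply: tB.
have tauE a : t - iota a = tau - iota (a - a0) by rewrite /tau rmorphB; ring.
have [[b b0 tbU]|no_unit] := pselect (exists2 b, b != 0 & tau / iota b \in val_unit B).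
- have ib0 : iota b != 0 by rewrite fmorph_eq0.
  pose beta (e : F * F) := (e.1 - a0) / b; pose sigma := tau / iota b.
  have [||y yA yU] := @residue_avoid F A [seq x <- map beta s | x \in A] hA.
  + rewrite -has_filter; apply/hasP; exists (beta e0); first exact: map_f.
    by rewrite /beta /a0 subrr mul0r vring0.
  + by move=> x; rewrite mem_filter => /andP[].
  exists (a0 + b * y) => e es.
  have tE : t - iota e.1 = iota b * (sigma - iota (beta e)).
    by rewrite tauE /sigma /beta fmorph_div mulrBr !(mulrC (iota b)) !divfK.
  have t'E : a0 + b * y - e.1 = b * (y - beta e) by rewrite /beta; field.
  (* Both t - a and t' - a have the same value as some element of the base field. *)
  have [c c0 [tc t'c]] : exists2 c, c != 0 &
      (sigma - iota (beta e)) / iota c \in val_unit B /\ (y - beta e) / c \in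
        val_unit A.
    have [eA|eA] := boolP (beta e \in A).
      exists 1; first exact: oner_neq0.
      rewrite rmorph1 !divr1; split; last by apply: yU; rewrite mem_filter eA map_f.
      have : sigma - iota (beta e) \in B.
        by apply: vringB => //; [apply: vunit_vring|rewrite hAB].
      have := e0P e es; rewrite invrK -/a0 -/tau tE => h hin.
      have s0 : sigma - iota (beta e) != 0.
        by have := tB e.1; rewrite tE mulf_eq0 => /norP[].
      apply/and3P; split=> //; move: h; rewrite invfM [_ * tau]mulrC mulrA -/sigma.
      by rewrite vring_unitMl.
    have be0 : beta e != 0 by apply: contraNneq eA => ->; rewrite vring0.
    have em : (beta e)^-1 \in val_max A by apply: vring_notin.
    exists (beta e) => //; split.
      rewrite mulrBl divff ?fmorph_eq0 //; apply: vunitBmax (vunit1 hB) => //.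
      apply: vmaxMl => //; first exact: vunit_vring.
      by rewrite -fmorphV (ext_max hAB).
    rewrite mulrBl divff //; apply: vunitBmax (vunit1 hA) => //.
    exact: vmaxMl.
  split.
    rewrite -subr_eq0 t'E mulf_neq0 //.
    by have := vunit_neq0 t'c; rewrite mulf_eq0 => /norP[].
  have e20 := s2 e es; have ic0 : iota c != 0 by rewrite fmorph_eq0.
  have -> : (t - iota e.1) / iota e.2 =
      ((sigma - iota (beta e)) / iota c) * iota (c * b / e.2).
    rewrite tE fmorph_div rmorphM; move: (sigma - _) => x.
    by field; apply/andP; split; rewrite // fmorph_eq0.
  have -> : (a0 + b * y - e.1) / e.2 = ((y - beta e) / c) * (c * b / e.2).
    by rewrite t'E; move: (y - _) => x; field; apply/andP; split.
  exact: same_class_unit.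
have cut c : c != 0 -> iota c / tau \in val_max B \/ tau / iota c \in val_max B.
  move=> c0; have ctau0 : tau / iota c != 0 by rewrite mulf_neq0 ?invr_eq0 ?fmorph_eq0.
  case: (val_trichotomy hB ctau0) => [cU|cm|]; last by rewrite invf_div; left.
    by case: no_unit; exists c.
  by right.
pose cs := [seq c <- [seq e.1 - a0 | e <- s] ++ [seq e.2 | e <- s] | c != 0].
have [|tau' tau'0 tau'P] := fill_cut (s := cs) tau0.
  by move=> c; rewrite mem_filter => /andP[].
exists (a0 + tau') => e es; have e20 := s2 e es.
have ie20 : iota e.2 != 0 by rewrite fmorph_eq0.
have e2cs : e.2 \in cs by rewrite mem_filter e20 mem_cat map_f ?orbT.
have t'E : a0 + tau' - e.1 = tau' - (e.1 - a0) by ring.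
have bcs : e.1 - a0 != 0 -> e.1 - a0 \in cs.
  by move=> b0; rewrite mem_filter b0 mem_cat (map_f (fun e : F * F => e.1 - a0)).
rewrite tauE -subr_eq0 t'E; move: (e.1 - a0) bcs => b bcs.
have [[b0 bm]|nb] := pselect (b != 0 /\ tau / iota b \in val_max B).
- have [_ /(_ bm) bm'] := tau'P b (bcs b0).
  have ib0 : iota b != 0 by rewrite fmorph_eq0.
  have U : (tau - iota b) / iota b \in val_unit B.
    by rewrite mulrBl divff //; apply: vunitBmax (vunit1 hB).
  have U' : (tau' - b) / b \in val_unit A.
    by rewrite mulrBl divff //; apply: vunitBmax (vunit1 hA).
  split; first by have := vunit_neq0 U'; rewrite mulf_eq0 => /norP[].
  have -> : (tau - iota b) / iota e.2 = (tau - iota b) / iota b * iota (b / e.2).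
    by rewrite fmorph_div mulrA divfK.
  have -> : (tau' - b) / e.2 = (tau' - b) / b * (b / e.2) by rewrite mulrA divfK.
  exact: same_class_unit.
have [bm bm'] : iota b / tau \in val_max B /\ b / tau' \in val_max A.
  have [->|b0] := eqVneq b 0; first by rewrite rmorph0 !mul0r !vmax0.
  have [bm|bm] := cut b b0; last by case: nb.
  by have [/(_ bm)] := tau'P b (bcs b0).
have U : (tau - iota b) / tau \in val_unit B.
  by rewrite mulrBl divff // -opprB; apply: vunitN => //; apply: vunitBmax (vunit1 hB).
have U' : (tau' - b) / tau' \in val_unit A.
  by rewrite mulrBl divff // -opprB; apply: vunitN => //; apply: vunitBmax (vunit1 hA).
split; first by have := vunit_neq0 U'; rewrite mulf_eq0 => /norP[].
have -> : (tau - iota b) / iota e.2 = (tau - iota b) / tau * (tau / iota e.2).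
  by rewrite mulrA divfK.
have -> : (tau' - b) / e.2 = (tau' - b) / tau' * (tau' / e.2) by rewrite mulrA divfK.
apply: same_class_unitM => //.
have [low upp] := tau'P _ e2cs.
have [cm|cm] := cut _ e20.
  by apply: same_classV; rewrite !invf_div;
    apply: same_class_max (low cm) => //; rewrite mulf_neq0 ?invr_eq0.
by apply: same_class_max (upp cm) => //; rewrite mulf_neq0 ?invr_eq0.
Qed.

End Approximation.

(** * Valuations of a rational function field *)

Lemma fraction_lift (R : idomainType) (L : fieldType) (psi : {rmorphism R -> L}) :
    injective psi ->
  exists g : {rmorphism {fraction R} -> L},
    forall x, g (FracField.tofrac x) = psi x.
Proof.
move=> psi_inj.
have psi0 (b : R) : b != 0 -> psi b != 0 by move=> b0;
  rewrite -(rmorph0 psi) (inj_eq psi_inj).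
have ratio (y : {fraction R}) : exists p : R * R,
    p.2 != 0 /\ y = FracField.tofrac p.1 / FracField.tofrac p.2.
  by have [a [b ?]] := tofracP y; exists (a, b).
have [n nP] := choice ratio.
pose g y := psi (n y).1 / psi (n y).2.
have gE (a b : R) : b != 0 -> g (FracField.tofrac a / FracField.tofrac b) = psi
  a / psi b.
  move=> b0; rewrite /g; set y := FracField.tofrac a / _; have [n0 yE] := nP y.
  apply/eqP; rewrite eqr_div ?psi0 // -!rmorphM (inj_eq psi_inj) -tofrac_eq !tofracM.
  by rewrite -eqr_div ?tofrac_eq0 // -yE.
have gB : zmod_morphism g.
  move=> x y; have [a [b [b0 ->]]] := tofracP x; have [c [d [d0 ->]]] := tofracP y.
  have b1 := b0; have d1 := d0; rewrite -tofrac_eq0 in b1; rewrite -tofrac_eq0 in d1.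
  rewrite -mulNr addf_div // -tofracN -!tofracM -tofracD !gE ?mulf_neq0 //.
  by rewrite rmorphD !rmorphM rmorphN -addf_div ?psi0 // mulNr.
have gM : monoid_morphism g.
  split=> [|x y].
    have -> : (1 : {fraction R}) = FracField.tofrac 1 / FracField.tofrac 1 by
      rewrite divff ?oner_neq0.
    by rewrite gE ?oner_neq0 // rmorph1 divff ?oner_neq0.
  have [a [b [b0 ->]]] := tofracP x; have [c [d [d0 ->]]] := tofracP y.
  by rewrite mulf_div -!tofracM !gE ?mulf_neq0 // !rmorphM mulf_div.
pose gA := GRing.isZmodMorphism.Build _ _ g gB.
pose gR := GRing.isMonoidMorphism.Build _ _ g gM.
pose h : {rmorphism {fraction R} -> L} := HB.pack g gA gR.
exists h.
move=> x /=; have := gE x 1 (oner_neq0 _).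
by rewrite !rmorph1 !divr1.
Qed.

Section Transfer.
Variables (F : closedFieldType) (E : fieldType) (A : {pred F}) (B1 B2 : {pred E}).
Variables (kappa : {rmorphism F -> E}) (t : E).
Hypotheses (h1 : valuation_ring B1) (h2 : valuation_ring B2).
Hypothesis hA1 : forall a, (kappa a \in B1) = (a \in A).
Hypothesis hA2 : forall a, (kappa a \in B2) = (a \in A).
Hypothesis tF : forall a, t != kappa a.
Hypothesis tB : forall a d, d != 0 ->
  let x := (t - kappa a) / kappa d in
  (x \in B1) = (x \in B2) /\ (x^-1 \in B1) = (x^-1 \in B2).

Local Notation ev p := (map_poly kappa p).[t].

Definition unit12 (x : E) := (x \in val_unit B1) && (x \in val_unit B2).

Lemma unit12M x y : unit12 x -> unit12 y -> unit12 (x * y).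
Proof. by move=> /andP[x1 x2] /andP[y1 y2]; rewrite /unit12 !vunitM. Qed.

Lemma unit12V x : unit12 x -> unit12 x^-1.
Proof. by move=> /andP[x1 x2]; rewrite /unit12 !vunitV. Qed.

Lemma unit12_linear a d : d != 0 -> let x := (t - kappa a) / kappa d in
  x \in val_unit B1 -> unit12 x.
Proof.
move=> d0 x xU; rewrite /unit12 xU; have [e1 e2] := tB a d0.
by move: xU; rewrite !vunitE e1 e2.
Qed.

(** Up to units of both valuations, all t - a are of the form c or c tau, where
    tau = 1 when every t - a has the value of an element of F, and tau is any t - a0
    that has no such value otherwise: then the value of t - a is that of a - a0
    or of t - a0, whichever is the larger in absolute value. *)
Lemma generator : exists2 tau : E, tau != 0 &
  (forall a, exists c n, c != 0 /\ unit12 ((t - kappa a) / (kappa c * tau ^+ n))) /\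
  (forall d, d != 0 -> (tau / kappa d \in B1 -> tau / kappa d \in B2) /\
     (kappa d / tau \in B1 -> kappa d / tau \in B2)).
Proof.
have [all_unit|/existsNP[a0 no_unit]] := pselect (forall a, exists2 c, c != 0 &
    (t - kappa a) / kappa c \in val_unit B1).
  exists 1; first exact: oner_neq0.
  split=> [a|d d0].
    have [c c0 /unit12_linear u] := all_unit a.
    by exists c, 0%N; rewrite expr0 mulr1; split=> //; apply: u.
  by rewrite div1r divr1 -fmorphV !hA1 !hA2.
have t0 a : t - kappa a != 0 by rewrite subr_eq0.
pose tau := t - kappa a0; have tau0 : tau != 0 by apply: t0.
exists tau => //; split=> [a|d d0]; last first.
  have [E1 E2] := tB a0 d0; rewrite -/tau invf_div in E1 E2.
  by rewrite E1 E2.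
have tE : t - kappa a = tau - kappa (a - a0) by rewrite /tau rmorphB; ring.
have [b0|b0] := eqVneq (a - a0) 0.
  exists 1, 1%N; rewrite oner_neq0 rmorph1 mul1r tE b0 rmorph0 subr0 expr1 divff //.
  by rewrite /unit12 !vunit1.
have kb0 : kappa (a - a0) != 0 by rewrite fmorph_eq0.
have taub0 : tau / kappa (a - a0) != 0 by rewrite mulf_neq0 ?invr_eq0.
case: (val_trichotomy h1 taub0) => [bU|bm|bm].
- by case: no_unit; exists (a - a0).
- exists (a - a0), 0%N; split=> //; rewrite expr0 mulr1.
  apply: unit12_linear => //; rewrite tE mulrBl divff //.
  exact: vunitBmax (vunit1 h1).
exists 1, 1%N; rewrite oner_neq0 rmorph1 mul1r expr1; split=> //.
have bm2 : (tau / kappa (a - a0))^-1 \in val_max B2.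
  have taub0V : (tau / kappa (a - a0))^-1 != 0 by rewrite invr_eq0.
  by move: bm; rewrite !vmaxE // invrK; have [-> _] := tB a0 b0.
rewrite tE mulrBl divff // -invf_div -opprB /unit12.
by rewrite !vunitN // vunitBmax ?vunit1.
Qed.

(** Polynomials over F split, so each rational function is c tau^k up to units of both
    valuations, and its integrality is that of c if k = 0, and otherwise that of
    tau / g or g / tau for a |k|-th root g of 1/c or c. *)
Lemma transfer f p q : f = ev p / ev q -> q != 0 -> f \in B1 -> f \in B2.
Proof.
have [tau tau0 [lin tauP]] := generator.
have poly (g : {poly F}) : g != 0 ->
    exists c n, c != 0 /\ unit12 (ev g / (kappa c * tau ^+ n)).
  have [s ->] := closed_field_poly_normal g; move: (lead_coef g) => l.
  have [->|l0 _] := eqVneq l 0; first by rewrite scale0r eqxx.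
  elim: s => [|z s [c [n [c0 U]]]].
    exists l, 0%N; split=> //; rewrite big_nil alg_polyC map_polyC hornerC mulr1.
    by rewrite divff ?fmorph_eq0 // /unit12 !vunit1.
  have [d [m [d0 U']]] := lin z.
  exists (c * d), (n + m)%N; split; first exact: mulf_neq0.
  have := unit12M U U'; rewrite big_cons; congr (unit12 _).
  rewrite mulf_div; congr (_ / _); last by rewrite rmorphM exprD mulrACA.
  rewrite -!mul_polyC !rmorphM /= !hornerM map_polyC !hornerC rmorphB /= map_polyX.
  by rewrite map_polyC hornerD hornerN hornerX hornerC; ring.
move=> -> q0; have [->|p0] := eqVneq p 0.
  by rewrite rmorph0 horner0 mul0r !vring0.
have [c [n [c0 Up]]] := poly p p0; have [d [m [d0 Uq]]] := poly q q0.
have kc0 : kappa c != 0 by rewrite fmorph_eq0.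
have kd0 : kappa d != 0 by rewrite fmorph_eq0.
pose u := ev p / (kappa c * tau ^+ n) / (ev q / (kappa d * tau ^+ m)).
have /andP[u1 u2] : unit12 u by apply: unit12M => //; apply: unit12V.
have evq0 : ev q != 0.
  by case/andP: Uq => /vunit_neq0; rewrite mulf_eq0 => /norP[].
have -> : ev p / ev q = u * (kappa (c / d) * (tau ^+ n / tau ^+ m)).
  rewrite /u fmorph_div; move: (ev p) (ev q) evq0 => x y y0.
  by field; rewrite !expf_neq0 ?kc0 ?kd0 ?y0.
rewrite (vring_unitMl h1 _ u1) (vring_unitMl h2 _ u2);
  have cd0 : c / d != 0 by rewrite mulf_neq0 ?invr_eq0.
move: (c / d) cd0 => {c0 d0 kc0 kd0 Up Uq u u1 u2 evq0} e e0.
have ke0 : kappa e != 0 by rewrite fmorph_eq0.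
have [lt_nm|lt_mn|->] := ltngtP n m.
- have [k Dk] : exists k, m = (n + k.+1)%N.
    by exists (m - n).-1; rewrite prednK ?subn_gt0 // subnKC // ltnW.
  have [g gE] := closed_nth_root k e.
  have g0 : g != 0 by apply: contraNneq e0 => g0; rewrite -gE g0 expr0n.
  have -> : kappa e * (tau ^+ n / tau ^+ m) = (kappa g / tau) ^+ k.+1.
    rewrite Dk exprD expr_div_n -rmorphXn gE; move: (k.+1) => k'.
    by field; rewrite !expf_neq0.
  move=> /(vringXK h1) gB; apply: vringX => //.
  by have [_] := tauP g g0; apply.
- have [k Dk] : exists k, n = (m + k.+1)%N.
    by exists (n - m).-1; rewrite prednK ?subn_gt0 // subnKC // ltnW.
  have [g gE] := closed_nth_root k e^-1.
  have g0 : g != 0 by apply: contraNneq e0 => g0; rewrite -invr_eq0 -gE g0 expr0n.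
  have -> : kappa e * (tau ^+ n / tau ^+ m) = (tau / kappa g) ^+ k.+1.
    rewrite Dk exprD expr_div_n -rmorphXn gE fmorphV; move: (k.+1) => k'.
    by field; rewrite ke0 oner_neq0 expf_neq0.
  move=> /(vringXK h1) gB; apply: vringX => //.
  by have [+ _] := tauP g g0; apply.
- by rewrite divff ?expf_neq0 // mulr1 hA1 hA2.
Qed.

End Transfer.

(** * Points of algebraically closed valued fields *)

Lemma eval_injective (F : closedFieldType) (L : fieldType) (iota : {rmorphism F -> L})
    (t : L) : (forall a, t != iota a) ->
  injective (fun p : {poly F} => (map_poly iota p).[t]).
Proof.
move=> tF p q /eqP; rewrite -subr_eq0 -hornerN -hornerD -rmorphB => pq0.
apply/eqP; rewrite -subr_eq0; move: (p - q) pq0 => {p q} p.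
have [s ->] := closed_field_poly_normal p.
rewrite -mul_polyC rmorphM /= map_polyC hornerM hornerC mulf_eq0 fmorph_eq0.
case/orP=> [/eqP->|]; first by rewrite mul0r.
rewrite rmorph_prod horner_prod prodf_seq_eq0 => /hasP[z _] /=.
by rewrite rmorphB /= map_polyX map_polyC hornerXsubC subr_eq0 (negPf (tF z)).
Qed.

(** F(t) carries the valuation induced by L, and embeds in an ultraproduct M of copies
    of F, indexed by the possible approximations t' of t in F, by sending t to the
    class of the identity function. *)
Theorem one_variable_extension (F : closedFieldType) (L : fieldType)
    (A : {pred F}) (B : {pred L}) (iota : {rmorphism F -> L}) (t : L) :
    valuation_ring A -> valuation_ring B ->
    (forall a, (iota a \in B) = (a \in A)) ->
    (exists y, y \notin A) -> (forall a, t != iota a) ->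
  exists (E : fieldType) (kappa : {rmorphism F -> E}) (psi1 : {rmorphism E -> L})
      (M : closedFieldType) (BM : {pred M}) (psi2 : {rmorphism E -> M}),
    [/\ (forall a, psi1 (kappa a) = iota a) /\ (exists u, psi1 u = t),
        valuation_ring BM, exists y, y \notin BM,
        forall e, (psi2 e \in BM) = (psi1 e \in B)
      & forall (K : fieldType) (j : {rmorphism K -> F}) (h : {rmorphism K -> M})
          (r : nat) (Req0 Rneq0 RVr RRn RU : seq {mpoly K[r]}) (y : 'I_r -> M),
          (forall c, h c = psi2 (kappa (j c))) ->
          solution_set BM h Req0 Rneq0 RVr RRn RU y ->
        exists z, solution_set A j Req0 Rneq0 RVr RRn RU z].
Proof.
move=> hA hB hAB ntA tF.
pose PF : pointedType := HB.pack (GRing.ClosedField.sort F) (isPointed.Build F 0).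
(* Large sets: those containing every point that approximates t at finitely
   many centres and radii. *)
pose near (s : seq (F * F)) : set PF := [set t' | {in s, forall e, t' != e.1 /\
  same_class A B ((t - iota e.1) / iota e.2) ((t' - e.1) / e.2)}]%classic.
pose G (T : set PF) := exists2 s : seq (F * F), {in s, forall e, e.2 != 0} &
  forall t', near s t' -> T t'.
have GT : G setT by exists [::].
have GI S T : G S -> G T -> G (S `&` T)%classic.
  move=> [s s0 sS] [s' s'0 s'T]; exists (s ++ s').
    by move=> e; rewrite mem_cat => /orP[/s0|/s'0].
  move=> t' nt'; split; [apply: sS|apply: s'T] => e es; apply: nt';
    by rewrite mem_cat es ?orbT.
have Gn S : G S -> exists i, S i.
  move=> [s s0 sS]; have [t' t'P] := approximate hA hB hAB ntA tF s0.
  by exists t'; apply: sS.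
have [M [BM [phi [D [[hBM surj] [hD DG] phi0 phiB phiV]]]]] := ultraproduct hA GT GI Gn.
have [Dn DI DC] := hD.
have iotaMB : zmod_morphism (fun c : F => phi (fun _ : PF => c)).
  by move=> a b; rewrite -rmorphB; congr (phi _).
have iotaMM : monoid_morphism (fun c : F => phi (fun _ : PF => c)).
  split; first by rewrite -(rmorph1 phi); congr (phi _).
  by move=> a b; rewrite -rmorphM; congr (phi _).
have [iotaM iotaME] : exists h : {rmorphism F -> M}, forall c, h c = phi (fun _ => c).
  pose hB' := GRing.isZmodMorphism.Build _ _ _ iotaMB.
  pose hM' := GRing.isMonoidMorphism.Build _ _ _ iotaMM.
  pose h : {rmorphism F -> M} := HB.pack (fun c : F => phi (fun _ : PF => c)) hB' hM'.
  by exists h.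
have hAM a : (iotaM a \in BM) = (a \in A).
  rewrite iotaME; apply/idP/idP => [/phiB/Dn[]//|aA]; apply/phiB.
  by apply: ultraS (ultraT hD).
pose tM : M := phi (id : PF -> F).
(* The class of the identity function has the same position as t with respect to F. *)
have near1 a d : d != 0 -> D [set t' | t' != a /\
    same_class A B ((t - iota a) / iota d) ((t' - a) / d)]%classic.
  move=> d0; apply: DG; exists [:: (a, d)]; first by move=> e; rewrite inE => /eqP->.
  by move=> t' nt'; apply: (nt' (a, d)); rewrite mem_head.
have tME a d : (tM - iotaM a) / iotaM d = phi (fun t' : PF => (t' - a) / d).
  rewrite -fmorphV !iotaME -rmorphB -rmorphM; congr (phi _).
have tMF a : tM != iotaM a.
  rewrite -subr_eq0; apply/eqP; rewrite /tM iotaME -rmorphB => /phi0 Da.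
  have [i []] := Dn _ ((DI _ _).2 (conj Da (near1 a 1 (oner_neq0 _)))).
  move=> /= ia [/eqP ina _]; apply: ina; apply/eqP; rewrite -subr_eq0; apply/eqP.
  exact: ia.
have same_in (x : L) (f : PF -> F) : D [set t' | (x \in B) = (f t' \in A)]%classic ->
    (phi f \in BM) = (x \in B).
  move=> Dx; apply/idP/idP => [/phiB Df|xB].
    by have [i [/= <-]] := Dn _ ((DI _ _).2 (conj Dx Df)).
  by apply/phiB; apply: (ultraS hD) Dx => i /= <-.
have same_pos a d : d != 0 ->
    let x := (t - iota a) / iota d in let y := (tM - iotaM a) / iotaM d in
    (x \in B) = (y \in BM) /\ (x^-1 \in B) = (y^-1 \in BM).
  move=> d0 x y; rewrite /y tME -phiV; split; apply/esym/same_in.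
    by apply: (ultraS hD) (near1 a d d0) => i /= [_ []].
  by apply: (ultraS hD) (near1 a d d0) => i /= [_ []].
pose E : fieldType := {fraction {poly F}}.
pose kappa : {rmorphism F -> E} := @FracField.tofrac {poly F} \o polyC.
pose ev1 : {rmorphism {poly F} -> L} := horner_eval t \o map_poly iota.
pose ev2 : {rmorphism {poly F} -> M} := horner_eval tM \o map_poly iotaM.
have [psi1 psi1E] := fraction_lift (psi := ev1) (eval_injective tF).
have [psi2 psi2E] := fraction_lift (psi := ev2) (eval_injective tMF).
pose X : E := FracField.tofrac 'X.
have psi1k a : psi1 (kappa a) = iota a.
  by rewrite [LHS]psi1E /= /horner_eval map_polyC hornerC.
have psi2k a : psi2 (kappa a) = iotaM a.
  by rewrite [LHS]psi2E /= /horner_eval map_polyC hornerC.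
have psi1X : psi1 X = t by rewrite psi1E /= /horner_eval map_polyX hornerX.
have psi2X : psi2 X = tM by rewrite psi2E /= /horner_eval map_polyX hornerX.
have EX p : FracField.tofrac p = (map_poly kappa p).[X] :> E.
  by rewrite map_poly_comp horner_map -/(comp_poly _ _) comp_polyXr.
pose B1 := pullback psi1 B; pose B2 := pullback psi2 BM.
have h1 : valuation_ring B1 by apply: pullback_valuation.
have h2 : valuation_ring B2 by apply: pullback_valuation.
have hA1 a : (kappa a \in B1) = (a \in A) by rewrite inE /= psi1k.
have hA2 a : (kappa a \in B2) = (a \in A) by rewrite inE /= psi2k.
have XF a : X != kappa a.
  by apply: contra_neq (tF a) => Xa; rewrite -psi1X Xa psi1k.
have tB a d : d != 0 -> let x := (X - kappa a) / kappa d in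
    (x \in B1) = (x \in B2) /\ (x^-1 \in B1) = (x^-1 \in B2).
  move=> d0 x; rewrite !inE /= !fmorphV !fmorph_div !rmorphB psi1X psi2X !psi1k !psi2k.
  exact: same_pos.
have B12 e : (psi2 e \in BM) = (psi1 e \in B).
  have [p [q [q0 eE]]] := tofracP e; rewrite !EX in eE.
  apply/idP/idP => eB.
    apply: (transfer h2 h1 hA2 hA1 XF _ eE q0 eB) => a d d0 x.
    by have [e1 e2] := tB a d d0; split; apply/esym.
  exact: (transfer h1 h2 hA1 hA2 XF tB eE q0 eB).
exists E, kappa, psi1, M, BM, psi2; split=> //.
- by split=> //; exists X.
- by have [y yA] := ntA; exists (iotaM y); rewrite hAM.
move=> K j h r Req0 Rneq0 RVr RRn RU y hE sol.
have [f fE] := choice (fun i => surj (y i)).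
pose pt (p : {mpoly K[r]}) : PF -> F := fun i => (map_mpoly j p).@[fun k => f k i].
have ptB : zmod_morphism (fun p => phi (pt p)).
  by move=> p q; rewrite -rmorphB; congr (phi _); apply/funext => i;
    rewrite /pt !rmorphB.
have ptM : monoid_morphism (fun p => phi (pt p)).
  split=> [|p q].
    by rewrite -(rmorph1 phi); congr (phi _); apply/funext => i; rewrite /pt !rmorph1.
  by rewrite -rmorphM; congr (phi _); apply/funext => i; rewrite /pt !rmorphM.
pose ptA := GRing.isZmodMorphism.Build _ _ _ ptB.
pose ptR := GRing.isMonoidMorphism.Build _ _ _ ptM.
pose ptphi : {rmorphism {mpoly K[r]} -> M} := HB.pack (fun p => phi (pt p)) ptA ptR.
have ptE p : (map_mpoly h p).@[y] = phi (pt p).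
  apply: (mpoly_rmorph_eval (phi := ptphi)) => [c|i] /=.
    rewrite hE psi2k iotaME; congr (phi _); apply/funext => i.
    by rewrite /pt map_mpolyC mevalC.
  rewrite fE; congr (phi _); apply/funext => k.
  by rewrite /pt map_mpolyX mevalXU.
have sat : satisfies BM (fun p => phi (pt p)) Req0 Rneq0 RVr RRn RU.
  by have [s1 s2 s3 s4 s5] := sol; split=> p /[dup] pR; rewrite -ptE; auto.
have [i iP] := los hD phi0 phiB phiV sat.
by exists (fun k => f k i).
Qed.

(** By induction on the set S of the indices of the coordinates that may be outside
    K.  The point of L is only used to exclude certificates over K; the extension L1
    of F that replaces L is such that a new coordinate, transcendental over F, can be
    adjoined to F inside both L1 and an ultraproduct of F. *)
Theorem existentially_closed (r : nat) (S : {set 'I_r})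
    (K L : fieldType) (F : closedFieldType)
    (A : {pred K}) (B : {pred L}) (A' : {pred F})
    (iota : {rmorphism K -> L}) (j : {rmorphism K -> F})
    (Req0 Rneq0 RVr RRn RU : seq {mpoly K[r]}) (x : 'I_r -> L) :
    valuation_ring A -> valuation_ring B -> valuation_ring A' ->
    (forall a, (iota a \in B) = (a \in A)) ->
    (forall a, (j a \in A') = (a \in A)) ->
    (exists y, y \notin A') ->
    (forall i, i \notin S -> exists a, x i = iota a) ->
    solution_set B iota Req0 Rneq0 RVr RRn RU x ->
  exists y, solution_set A' j Req0 Rneq0 RVr RRn RU y.
Proof.
have [n] := ubnP #|S|.
elim: n => // n IH in S K L F A B A' iota j Req0 Rneq0 RVr RRn RU x *.
move=> leS hA hB hA' hAB hAA' ntA' Sx sol.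
have known i : exists a, i \notin S -> x i = iota a.
  have [iS|iS] := boolP (i \in S); first by exists 0.
  by have [a] := Sx i iS; exists a.
have [c cP] := choice known.
(* The known coordinates are prescribed by additional equations. *)
pose Req1 := Req0 ++ [seq 'X_i - (c i)%:MP | i <- enum (~: S)].
have noc : ~ certificate A' (map (map_mpoly j) Req1) (map (map_mpoly j) Rneq0)
    (map (map_mpoly j) RVr) (map (map_mpoly j) RRn) (map (map_mpoly j) RU).
  move/(certificate_descent hA hA' hAA').
  apply: (point_no_certificate hB hAB (x := x)).
  have [s0 s1 s2 s3 s4] := sol; split=> // p.
  rewrite mem_cat => /orP[/s0//|/mapP[i iS ->]].
  move: iS; rewrite mem_enum inE => iS.
  by rewrite rmorphB /= map_mpolyX map_mpolyC mevalB mevalXU mevalC cP // subrr.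
have [L1 [B1 [iota1 [x1 [hB1 hAB1 sol1]]]]] := no_certificate_point hA' noc.
have {}sol1 : satisfies B1 (fun p => (map_mpoly iota1 (map_mpoly j p)).@[x1])
    Req1 Rneq0 RVr RRn RU.
  by move: sol1; apply: (satisfies_map B1 _ _ _ _ _ _).1.
have x1S i : i \notin S -> x1 i = iota1 (j (c i)).
  move=> iS; apply/eqP; rewrite -subr_eq0.
  have inR : 'X_i - (c i)%:MP \in Req1.
    rewrite mem_cat; apply/orP; right; apply/mapP; exists i => //.
    by rewrite mem_enum inE.
  have [/(_ _ inR) + _ _ _ _] := sol1.
  by rewrite !rmorphB /= !map_mpolyX !map_mpolyC mevalXU mevalC => ->.
have {}sol1 : satisfies B1 (fun p => (map_mpoly iota1 (map_mpoly j p)).@[x1])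
    Req0 Rneq0 RVr RRn RU.
  by have [s0 s1 s2 s3 s4] := sol1; split=> // p pR; apply: s0; rewrite mem_cat pR.
have [x1F|/existsNP[i0 x1i0]] := pselect (forall i, exists a, x1 i = iota1 a).
  have [y yE] := choice x1F; exists y.
  have evE (p : {mpoly F[r]}) : (map_mpoly iota1 p).@[x1] = iota1 p.@[y].
    pose phi : {rmorphism {mpoly F[r]} -> L1} := iota1 \o meval y.
    by apply: (mpoly_rmorph_eval (phi := phi)) => [a|i] /=; rewrite ?mevalC ?mevalXU.
  have [s0 s1 s2 s3 s4] := sol1; split=> p pR.
  - by apply/eqP; rewrite -(fmorph_eq0 iota1) -evE s0.
  - by rewrite -(fmorph_eq0 iota1) -evE s1.
  - by rewrite -hAB1 -evE s2.
  - by rewrite -(ext_unit hAB1) -evE s3.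
  - by rewrite -(ext_max hAB1) -evE s4.
have i0S : i0 \in S.
  by apply: contraT => /x1S xE; case: x1i0; exists (j (c i0)).
have tF a : x1 i0 != iota1 a by apply/eqP => xE; apply: x1i0; exists a.
have [E [kappa [psi1 [M [BM [psi2 [[psi1k [u ut]] hBM ntM psi12 down]]]]]]] :=
  one_variable_extension hA' hB1 hAB1 ntA' tF.
pose kj : {rmorphism K -> E} := kappa \o j.
pose g := @map_mpoly r K E kj.
have [|||||||||y soly] := IH (S :\ i0) E L1 M (pullback psi1 B1) B1 BM psi1 psi2
    (map g Req0) (map g Rneq0) (map g RVr) (map g RRn) (map g RU) x1 => //.
- by move: leS; rewrite (cardsD1 i0) i0S.
- exact: pullback_valuation.
- move=> i; rewrite !inE negb_and negbK => /orP[/eqP->|iS]; first by exists u.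
  by exists (kappa (j (c i))); rewrite psi1k x1S.
- move: sol1; apply: (satisfies_map B1 _ _ _ _ _ _).2.
  by move=> p; congr (_.@[_]); apply: map_mpoly_comp2 => a; apply: psi1k.
pose h : {rmorphism K -> M} := psi2 \o kj.
apply: (down K j h r Req0 Rneq0 RVr RRn RU y) => //.
have hE p : (map_mpoly psi2 (g p)).@[y] = (map_mpoly h p).@[y].
  congr (_.@[_]); apply/mpolyP => m; by rewrite !mcoeff_map_mpoly.
by have /satisfies_map := soly; apply.
Qed.

Theorem mainTheorem1 (K : fieldType) (A : {pred K})
    (K' : closedFieldType) (A' : {pred K'}) (iota : {rmorphism K -> K'})
    (r : nat) (Req0 Rneq0 RVr RRn RU : seq {mpoly K[r]})
    (hA : valuation_ring A) (hA' : valuation_ring A')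
    (hAA' : forall a : K, (iota a \in A') = (a \in A))
    (* (K', A') is not trivially valued: the equivalence fails for A' = K' *)
    (ntA' : exists y : K', y \notin A') :
  (~ exists x : 'I_r -> K',
     solution_set A' iota Req0 Rneq0 RVr RRn RU x) <->
  exists m u j i : {mpoly K[r]},
    [/\ M_neq0 Rneq0 m, M_U A RU u, I_Rn A RVr RRn RU j, I_eq0 Req0 i
      & m * (u + j) + i = 0].
Proof.
split=> [nosol|cert [x sol]]; last exact: (point_no_certificate hA' hAA' sol cert).
apply: contrapT => /(no_certificate_point hA)[L [B [kappa [x [hB hAB sol]]]]].
apply: nosol; apply: (existentially_closed (S :=
  [set: 'I_r]) hA hB hA' hAB hAA' ntA' _ sol).
by move=> i; rewrite inE.
Qed.
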